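(* Let $d\ge 0$ and let $Y_d\subseteq U_d$ be a Zariski closed, $\mathrm{GL}_d(K)$-stable subset (the set of algebraic structures on $K^d$ satisfying a prescribed set $\mathcal{T}$ of axioms). Then the $K$-algebra $K[Y_d]^{\mathrm{GL}_d(K)}$ is generated by (the restrictions to $Y_d$ of) the basic invariants $$p(n,\sigma,n_1,\ldots,n_r)=\mathrm{Tr}\big(L^{(n)}_{\sigma}\circ(x_1^{\otimes n_1}\otimes\cdots\otimes x_r^{\otimes n_r})\big),$$ where $(n_1,\ldots,n_r)\in\mathbb{N}^r$ runs over the tuples with $\sum_i p_in_i=\sum_i q_in_i=:n$ and $\sigma\in S_n$. All relations between these generators follow from (i.e. $K[Y_d]^{\mathrm{GL}_d(K)}$ is the commutative unital algebra on the symbols $p(n,\sigma,n_1,\ldots,n_r)$ modulo the ideal generated by) the following relations: (R0) (product) The product of two basic invariants is a basic invariant: $$p(n,\sigma,n_1,\ldots,n_r)\cdot p(n',\sigma',n'_1,\ldots,n'_r)=p\big(n+n',\ \mu_2^{-1}(\sigma,\sigma')\mu_1,\ n_1+n'_1,\ldots,n_r+n'_r\big),$$ with $p(0,\mathrm{id},0,\ldots,0)=1$. (R1) (cyclicity of trace) For every $(\mu_i)\in S_{n_1}\times\cdots\times S_{n_r}$, $$p(n,\sigma,n_1,\ldots,n_r)=p\big(n,\ \alpha^{(q_i)}_{(n_i)}((\mu_i))\,\sigma\,\alpha^{(p_i)}_{(n_i)}((\mu_i))^{-1},\ n_1,\ldots,n_r\big).$$ (R2) (dimension relations) If $n>d$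 and $\tau_1,\tau_2\in S_n$, then $$\sum_{\sigma\in S_{d+1}}(-1)^{\sigma}p(n,\tau_1\sigma\tau_2,n_1,\ldots,n_r)=0.$$ (R3) (axioms) Writing $I_{\mathcal{T},d}=\mathrm{Ker}(K[U_d]\to K[Y_d])$, all elements of $I_{\mathcal{T},d}^{\mathrm{GL}_d(K)}\subseteq K[U_d]^{\mathrm{GL}_d(K)}$ (expressed as polynomials in the basic invariants) are set equal to $0$.
   Context: $K$ is an algebraically closed field of characteristic zero, $\mathbb{N}=\{0,1,2,\ldots\}$, and a type $((p_1,q_1),\ldots,(p_r,q_r))\in(\mathbb{N}^2)^r$ is fixed. For a finite dimensional vector space $W$ put $W^{p,q}=W^{\otimes p}\otimes(W^* )^{\otimes q}\cong\mathrm{Hom}_K(W^{\otimes q},W^{\otimes p})$ (with $W^{\otimes 0}=K$). Let $U(W)=\bigoplus_{i=1}^r W^{p_i,q_i}$; its points $(x_i)$ are called algebraic structures on $W$, and $\mathrm{GL}(W)$ acts on it naturally. Put $U_d=U(K^d)$, viewed as an affine space with coordinate ring $K[U_d]$; $K[Y_d]$ is the coordinate ring of the (reduced) closed subset $Y_d$. For $\sigma\in S_n$, $L^{(n)}_\sigma:W^{\otimes n}\to W^{\otimes n}$ is $w_1\otimes\cdots\otimes w_n\mapsto w_{\sigma^{-1}(1)}\otimes\cdots\otimes w_{\sigma^{-1}(n)}$. If $\sum_i p_in_i=\sum_iq_in_i=n$, then $x_1^{\otimes n_1}\otimes\cdots\otimes x_r^{\otimes n_r}$ is an endomorphism of $W^{\otimes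 n}$, and the trace above is taken on $W^{\otimes n}$, $W=K^d$; this is a $\mathrm{GL}_d(K)$-invariant polynomial in $(x_i)$. $S_{d+1}\subseteq S_n$ is the subgroup fixing $d+2,\ldots,n$. Block permutations: for a sequence $\lambda=(m_1,\ldots,m_k)$ of nonnegative integers with sum $N$, let $I^\lambda_i=\{m_1+\cdots+m_{i-1}+1,\ldots,m_1+\cdots+m_i\}$. For $\sigma\in S_k$, $\Omega^\lambda(\sigma)\in S_N$ is the unique permutation that is increasing on each $I_i^\lambda$ and such that for $x\in I^\lambda_i$, $y\in I^\lambda_j$, $i\ne j$: $\Omega^\lambda(\sigma)(x)<\Omega^\lambda(\sigma)(y)$ iff $\sigma(i)<\sigma(j)$. $\Pi_\lambda:S_{m_1}\times\cdots\times S_{m_k}\to S_N$ is the embedding where $S_{m_i}$ permutes $I^\lambda_i$; $(\sigma,\sigma')$ denotes $\Pi_{(n,n')}(\sigma,\sigma')\in S_{n+n'}$. The homomorphism $\alpha^{(p_i)}_{(n_i)}:S_{n_1}\times\cdots\times S_{n_r}\to S_{\sum_i n_ip_i}$ is $\Pi_{(n_1p_1,\ldots,n_rp_r)}\circ(\Omega^{\lambda_1}\times\cdots\times\Omega^{\lambda_r})$ with $\lambda_i=(p_i,\ldots,p_i)$ ($n_i$ times), i.e. the $i$-th factor permutes $n_i$ consecutive blocks of size $p_i$; $\alpha^{(q_i)}_{(n_i)}$ is defined in the same way with $q_i$ in place of $p_i$. The permutations $\mu_1,\mu_2\in S_{n+n'}$ in (R0): let $\mu\in S_{2r}$ be $\mu(a)=(a+1)/2$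 for $a$ odd and $\mu(a)=a/2+r$ for $a$ even; then $\mu_1=\Omega^{\lambda}(\mu)$ for $\lambda=(n_1p_1,n_1'p_1,n_2p_2,n_2'p_2,\ldots,n_rp_r,n_r'p_r)$ and $\mu_2=\Omega^{\lambda'}(\mu)$ for $\lambda'=(n_1q_1,n_1'q_1,\ldots,n_rq_r,n_r'q_r)$. Equivalently, $(x_1^{\otimes n_1}\otimes\cdots\otimes x_r^{\otimes n_r})\otimes(x_1^{\otimes n'_1}\otimes\cdots\otimes x_r^{\otimes n'_r})=L^{(n+n')}_{\mu_1}(x_1^{\otimes(n_1+n_1')}\otimes\cdots\otimes x_r^{\otimes(n_r+n_r')})L^{(n+n')}_{\mu_2^{-1}}$. *)

(* Defs.v *)
From HB Require Import structures.
From mathcomp Require Import all_boot all_order all_algebra all_fingroup finmap.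
From mathcomp Require Import monalg mpoly.

Set Implicit Arguments.
Unset Strict Implicit.
Unset Printing Implicit Defensive.

Import GRing.Theory.
Local Open Scope ring_scope.

(* A tensor in W^{p,q} = Hom(W^{(x)q}, W^{(x)p}), W = R^d, is given by its
   matrix entries x (b, a) in the standard bases: b is the output multi-index
   (length p), a the input multi-index (length q).  The entries live in an
   arbitrary commutative ring, so that the same formulas apply to points
   (R = K) and to the generic point (R = K[U_d]). *)

Definition multi (d n : nat) := {ffun 'I_n -> 'I_d}.

Definition tensor (R : Type) (d p q : nat) :=
  {ffun multi d p * multi d q -> R}.

Section Tensors.
Variables (R : comNzRingType) (d : nat).

Definition tcomp p q s (x : tensor R d p q) (y : tensor R d q s) :
    tensor R d p s :=
  [ffun ba : multi d p * multi d s => \sum_(c : multi d q) x (ba.1, c) * y (c, ba.2)].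

Definition ttrace n (x : tensor R d n n) : R :=
  \sum_(b : multi d n) x (b, b).

(* The operator g^{(x)n} on W^{(x)n}. *)
Definition tpow (g : 'M[R]_d) n : tensor R d n n :=
  [ffun ba : multi d n * multi d n => \prod_(j < n) g (ba.1 j) (ba.2 j)].

(* The factor in position j moves to position s j, that is,
   w_1 (x) .. (x) w_n is sent to w_{s^-1(1)} (x) .. (x) w_{s^-1(n)}. *)
Definition Lperm n (s : 'S_n) : tensor R d n n :=
  [ffun ba : multi d n * multi d n => ([forall j, ba.1 (s j) == ba.2 j])%:R].

Definition block_index k (m : 'I_k -> nat) (b : multi d (\sum_i m i)) (i : 'I_k)
    : multi d (m i) :=
  [ffun j => b (tagnat.Rank i j)].

(* x_1 (x) .. (x) x_k *)
Definition tprod k (m l : 'I_k -> nat) (x : forall i, tensor R d (m i) (l i)) :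
    tensor R d (\sum_i m i) (\sum_i l i) :=
  [ffun ba : multi d (\sum_i m i) * multi d (\sum_i l i) =>
     \prod_(i < k) x i (block_index ba.1 i, block_index ba.2 i)].

Definition tcast p p' q q' (ep : p = p') (eq : q = q') (x : tensor R d p q) :
    tensor R d p' q' :=
  [ffun ba : multi d p' * multi d q' =>
     x ([ffun j => ba.1 (cast_ord ep j)],
        [ffun j => ba.2 (cast_ord eq j)])].

End Tensors.

Definition tact (R : comUnitRingType) d (g : 'M[R]_d) p q (x : tensor R d p q) : tensor R d p q :=
  tcomp (tcomp (tpow g p) x) (tpow (invmx g) q).

(* In MathComp (s * t) x = t (s x); pcomp is composition of functions, the
   convention for which L is multiplicative. *)
Definition pcomp n (s t : 'S_n) : 'S_n := (t * s)%g.

Section BlockPermutations.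
Variables (k : nat) (m : 'I_k -> nat).

(* tagnat.sig1 x is the block containing the position x. *)
Definition Omega_lt (s : 'S_k) (y x : 'I_(\sum_i m i)) : bool :=
  if tagnat.sig1 y == tagnat.sig1 x then (y < x)%N
  else (s (tagnat.sig1 y) < s (tagnat.sig1 x))%N.

Lemma Omega_lt_irr s : irreflexive (Omega_lt s).
Proof. by move=> x; rewrite /Omega_lt eqxx ltnn. Qed.

Lemma Omega_lt_trans s : transitive (Omega_lt s).
Proof.
move=> y x z; rewrite /Omega_lt.
case: (eqVneq (tagnat.sig1 x) (tagnat.sig1 y)) => [->|xy].
  by case: eqP => // _; apply: ltn_trans.
case: (eqVneq (tagnat.sig1 y) (tagnat.sig1 z)) => [<-|yz].
  by rewrite (negPf xy).
move=> h1 h2; have := ltn_trans h1 h2.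
by case: eqP => [->|//]; rewrite ltnn.
Qed.

Lemma Omega_lt_total s x y : x != y -> Omega_lt s x y || Omega_lt s y x.
Proof.
move=> xy; rewrite /Omega_lt [tagnat.sig1 y == _]eq_sym; case: eqP => h.
  by rewrite -neq_ltn.
by rewrite -neq_ltn; apply/eqP=> /val_inj/perm_inj.
Qed.

Lemma Omega_bound s x : (#|[set y | Omega_lt s y x]| < \sum_i m i)%N.
Proof.
rewrite -[X in (_ < X)%N]card_ord -cardsT; apply: proper_card.
by apply/properP; split; [apply: subsetT | exists x; rewrite !inE ?Omega_lt_irr].
Qed.

Definition Omega_fun s x : 'I_(\sum_i m i) := Ordinal (Omega_bound s x).

Lemma Omega_fun_mono s x y : (Omega_fun s x < Omega_fun s y)%N = Omega_lt s x y.
Proof.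
have homo u v : Omega_lt s u v -> (Omega_fun s u < Omega_fun s v)%N.
  move=> uv; apply: proper_card; apply/properP; split.
    by apply/subsetP=> w; rewrite !inE => /Omega_lt_trans; apply.
  by exists u; rewrite inE // Omega_lt_irr.
apply/idP/idP; last exact: homo.
case: (eqVneq x y) => [->|/(Omega_lt_total s)/orP[//|/homo h1 h2]].
  by rewrite ltnn.
by have := ltn_trans h1 h2; rewrite ltnn.
Qed.

Lemma Omega_fun_inj s : injective (Omega_fun s).
Proof.
move=> x y e; apply/eqP/negPn/negP=> /(Omega_lt_total s).
by rewrite -!Omega_fun_mono e ltnn.
Qed.

Definition Omega (s : 'S_k) : 'S_(\sum_i m i) := perm (@Omega_fun_inj s).

Definition block_perm_spec (s : 'S_k) (t : 'S_(\sum_i m i)) : Prop :=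
  (forall x y, tagnat.sig1 x = tagnat.sig1 y -> (x < y)%N -> (t x < t y)%N) /\
  (forall x y, tagnat.sig1 x <> tagnat.sig1 y ->
     (t x < t y)%N <-> (s (tagnat.sig1 x) < s (tagnat.sig1 y))%N).

Lemma OmegaP s : block_perm_spec s (Omega s).
Proof.
split=> x y; rewrite !permE Omega_fun_mono /Omega_lt; first by move=> ->; rewrite eqxx.
by move/eqP/negPf=> ->.
Qed.

Lemma Omega_unique s t : block_perm_spec s t -> t = Omega s.
Proof.
move=> [t1 t2].
have tE x y : (t x < t y)%N = Omega_lt s x y.
  rewrite /Omega_lt; case: eqP => [e|ne]; last by apply/idP/idP=> /t2; apply.
  case: (ltngtP x y) => [xy|yx|/val_inj->]; last by rewrite ltnn.
    exact: t1.
  by apply/negP=> h; have := ltn_trans h (t1 _ _ (esym e) yx); rewrite ltnn.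
apply/permP=> x; rewrite permE; apply/val_inj => /=.
transitivity #|t @: [set y | Omega_lt s y x]|; last by rewrite card_imset //; apply: perm_inj.
have -> : t @: [set y | Omega_lt s y x] = [set z : 'I__ | (z < t x)%N].
  apply/setP=> z; rewrite inE; apply/imsetP/idP => [[y]|lt_z].
    by rewrite inE -tE => h ->.
  by exists ((t^-1)%g z); rewrite ?inE -?tE permKV.
rewrite -sum1dep_card (big_ord_narrow (ltnW (ltn_ord (t x)))) /=.
by rewrite sum1_card card_ord.
Qed.

Definition Pi_perm_fun (s : forall i, 'S_(m i)) (x : 'I_(\sum_i m i)) :
    'I_(\sum_i m i) :=
  tagnat.Rank (tagnat.sig1 x) (s _ (tagnat.sig2 x)).

Lemma Pi_perm_fun_inj s : injective (Pi_perm_fun s).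
Proof.
apply: (@can_inj _ _ _ (Pi_perm_fun (fun i => (s i)^-1)%g)) => x.
rewrite /Pi_perm_fun /tagnat.sig1 /tagnat.sig2 /tagnat.Rank tagnat.rankK /= permK.
by rewrite -[RHS]tagnat.sigK; congr tagnat.rank; case: (tagnat.sig x).
Qed.

Definition Pi_perm (s : forall i, 'S_(m i)) : 'S_(\sum_i m i) :=
  perm (@Pi_perm_fun_inj s).

End BlockPermutations.

Section PairPerm.
Variables n n' : nat.

Definition pair_fun (s : 'S_n) (s' : 'S_n') (x : 'I_(n + n')) : 'I_(n + n') :=
  match split x with
  | inl i => lshift n' (s i)
  | inr j => rshift n (s' j)
  end.

Lemma pair_fun_inj s s' : injective (pair_fun s s').
Proof.
apply: (@can_inj _ _ _ (pair_fun s^-1%g s'^-1%g)) => x.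
rewrite -[RHS]splitK /pair_fun; case: (split x) => i.
  by rewrite (unsplitK (inl _)) permK.
by rewrite (unsplitK (inr _)) permK.
Qed.

Definition pair_perm s s' : 'S_(n + n') := perm (@pair_fun_inj s s').

End PairPerm.

(* The permutation mu of {1, .., 2r}, with indices starting from 0: a is sent
   to a/2 if a is even and to (a-1)/2 + r if a is odd. *)
Section Interleaving.
Variable r : nat.

Fact half_bound (a : 'I_(r + r)) : (a./2 < r)%N.
Proof. by rewrite ltn_half_double -addnn. Qed.

Definition half_ord (a : 'I_(r + r)) : 'I_r := Ordinal (half_bound a).

Definition mu_fun (a : 'I_(r + r)) : 'I_(r + r) :=
  if odd a then rshift r (half_ord a) else lshift r (half_ord a).

Lemma mu_fun_inj : injective mu_fun.
Proof.
move=> a b; rewrite /mu_fun => /(congr1 val) /=.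
have := half_bound a; have := half_bound b.
case: ifP => oa; case: ifP => ob /= hb ha e; apply: val_inj => /=.
- by rewrite -[LHS]odd_double_half -[RHS]odd_double_half oa ob (addnI e).
- by rewrite -e ltnNge leq_addr in hb.
- by rewrite e ltnNge leq_addr in ha.
- by rewrite -[LHS]odd_double_half -[RHS]odd_double_half oa ob e.
Qed.

Definition mu : 'S_(r + r) := perm mu_fun_inj.

(* (n_1 p_1, n'_1 p_1, .., n_r p_r, n'_r p_r) *)
Definition mu_blocks (p n n' : 'I_r -> nat) (a : 'I_(r + r)) : nat :=
  (p (half_ord a) * (if odd a then n' else n) (half_ord a))%N.

Lemma sum_mu_blocks p n n' :
  (\sum_a mu_blocks p n n' a = \sum_i p i * n i + \sum_i p i * n' i)%N.
Proof.
rewrite (reindex_inj (@perm_inj _ mu^-1%g)) big_split_ord.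
have odd_lr c : odd ((mu^-1)%g c) = (r <= c)%N.
  rewrite -{2}[c](permKV mu) [mu _]permE /mu_fun; case: ifP => _ /=.
    by rewrite leq_addr.
  by rewrite leqNgt half_bound.
congr (_ + _)%N; apply: eq_bigr => i _; rewrite /mu_blocks odd_lr /=.
  rewrite leqNgt ltn_ord /=; suff -> : half_ord ((mu^-1)%g (lshift r i)) = i by [].
  have := congr1 val (permKV mu (lshift r i)).
  by rewrite [mu _]permE /mu_fun odd_lr /= leqNgt ltn_ord /= => e; apply: val_inj.
rewrite leq_addr /=; suff -> : half_ord ((mu^-1)%g (rshift r i)) = i by [].
have := congr1 val (permKV mu (rshift r i)).
by rewrite [mu _]permE /mu_fun odd_lr /= leq_addr /= => /addnI e; apply: val_inj.
Qed.

End Interleaving.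

Section Structures.
Variables (r : nat) (p q : 'I_r -> nat).

(* The tuples (n_1, .., n_r) with sum p_i n_i = sum q_i n_i =: deg. *)
Definition balanced (ns : {ffun 'I_r -> nat}) : bool :=
  (\sum_i p i * ns i == \sum_i q i * ns i)%N.

Definition shape := {ns : {ffun 'I_r -> nat} | balanced ns}.

Definition deg (u : shape) : nat := (\sum_i p i * val u i)%N.

(* The symbol p(n, s, n_1, .., n_r) is Tagged _ s : sym, with s : 'S_(deg u) and
   u the tuple (n_1, .., n_r); n = deg u is determined by u. *)
Definition sym := {u : shape & 'S_(deg u)}.

Definition psym (u : shape) (s : 'S_(deg u)) : sym :=
  Tagged (fun u => 'S_(deg u)) s.

Fact sum_blocks (m ns : 'I_r -> nat) :
  (\sum_i \sum_(j < ns i) m i = \sum_i m i * ns i)%N.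
Proof. by apply: eq_bigr => i _; rewrite sum_nat_const card_ord mulnC. Qed.

Fact deg_out (u : shape) : (\sum_i \sum_(j < val u i) p i)%N = deg u.
Proof. exact: sum_blocks. Qed.

Fact deg_in (u : shape) : (\sum_i \sum_(j < val u i) q i)%N = deg u.
Proof. by rewrite sum_blocks -(eqP (valP u)). Qed.

(* Points of U_d with entries in R. *)
Definition algstr (R : Type) (d : nat) :=
  {dffun forall i : 'I_r, tensor R d (p i) (q i)}.

Definition gl_act (R : comUnitRingType) d (g : 'M[R]_d) (x : algstr R d) :
    algstr R d :=
  [ffun i => tact g (x i)].

Section BasicInvariants.
Variables (R : comNzRingType) (d : nat).

(* x_1^{(x)n_1} (x) .. (x) x_r^{(x)n_r} as an endomorphism of W^{(x)n} *)
Definition tmonomial (x : algstr R d) (u : shape) : tensor R d (deg u) (deg u) :=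
  tcast (deg_out u) (deg_in u)
    (tprod (fun i => tprod (fun _ : 'I_(val u i) => x i))).

Definition basic_inv (x : algstr R d) (s : sym) : R :=
  ttrace (tcomp (Lperm R d (tagged s)) (tmonomial x (tag s))).

End BasicInvariants.

Fact shape0_subproof : balanced [ffun _ => 0%N].
Proof. apply/eqP; by rewrite !big1 // => i _; rewrite ffunE muln0. Qed.

Definition shape0 : shape := exist balanced _ shape0_subproof.

Lemma weight_add (m : 'I_r -> nat) (u v : {ffun 'I_r -> nat}) :
  (\sum_i m i * [ffun i => u i + v i] i =
   \sum_i m i * u i + \sum_i m i * v i)%N.
Proof. by rewrite -big_split; apply: eq_bigr => i _; rewrite ffunE mulnDr. Qed.

Fact shape_add_subproof (u v : shape) :
  balanced [ffun i => val u i + val v i]%N.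
Proof. by rewrite /balanced !weight_add (eqP (valP u)) (eqP (valP v)). Qed.

Definition shape_add (u v : shape) : shape := exist balanced _ (shape_add_subproof u v).

Fact deg_add (u v : shape) : (deg u + deg v)%N = deg (shape_add u v).
Proof. by rewrite /deg weight_add. Qed.

Fact mu1_subproof (u v : shape) :
  (\sum_a mu_blocks p (val u) (val v) a)%N = (deg u + deg v)%N.
Proof. exact: sum_mu_blocks. Qed.

Fact mu2_subproof (u v : shape) :
  (\sum_a mu_blocks q (val u) (val v) a)%N = (deg u + deg v)%N.
Proof. by rewrite sum_mu_blocks /deg (eqP (valP u)) (eqP (valP v)). Qed.

Definition mu1 (u v : shape) : 'S_(deg u + deg v) :=
  cast_perm (mu1_subproof u v) (Omega _ (mu r)).

Definition mu2 (u v : shape) : 'S_(deg u + deg v) :=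
  cast_perm (mu2_subproof u v) (Omega _ (mu r)).

(* p(n+n', mu2^-1 (s, s') mu1, n_1+n'_1, .., n_r+n'_r) *)
Definition sym_mul (s t : sym) : sym :=
  psym (cast_perm (deg_add (tag s) (tag t))
    (pcomp (pcomp (mu2 (tag s) (tag t))^-1%g (pair_perm (tagged s) (tagged t)))
           (mu1 (tag s) (tag t)))).

Definition alpha (m : 'I_r -> nat) (ns : 'I_r -> nat)
    (t : forall i, 'S_(ns i)) : 'S_(\sum_i \sum_(j < ns i) m i) :=
  Pi_perm (fun i => Omega (fun _ : 'I_(ns i) => m i) (t i)).

Definition alpha_p (u : shape) (t : forall i, 'S_(val u i)) : 'S_(deg u) :=
  cast_perm (deg_out u) (alpha p t).

Definition alpha_q (u : shape) (t : forall i, 'S_(val u i)) : 'S_(deg u) :=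
  cast_perm (deg_in u) (alpha q t).

Section Presentation.
Variables (K : fieldType) (d : nat).

Definition entry (i : 'I_r) := (multi d (p i) * multi d (q i))%type.

Definition coord := {i : 'I_r & entry i}.

(* The coordinate ring K[U_d] *)
Definition KU := {mpoly K[#|{: coord}|]}.

Definition coord_val (x : algstr K d) (c : 'I_#|{: coord}|) : K :=
  x (tag (enum_val c)) (tagged (enum_val c)).

Definition peval (f : KU) (x : algstr K d) : K := f.@[coord_val x].

Definition generic_point : algstr KU d :=
  [ffun i => [ffun ba : entry i => 'X_(enum_rank (Tagged entry ba))]].

(* The basic invariant, as an element of K[U_d] *)
Definition inv_poly (s : sym) : KU := basic_inv generic_point s.

Definition zariski_closed (Y : algstr K d -> Prop) : Prop :=
  exists T : KU -> Prop, forall x, Y x <-> (forall f, T f -> peval f x = 0).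

Definition GL_stable (Y : algstr K d -> Prop) : Prop :=
  forall (g : 'M[K]_d) x, g \in unitmx -> Y x -> Y (gl_act g x).

(* The ideal of Y, i.e. the kernel of K[U_d] -> K[Y] *)
Definition vanishing_ideal (Y : algstr K d -> Prop) (f : KU) : Prop :=
  forall x, Y x -> peval f x = 0.

(* f and h have the same class in K[Y] *)
Definition eq_on (Y : algstr K d -> Prop) (f h : KU) : Prop :=
  vanishing_ideal Y (f - h).

(* The class of f in K[Y] lies in K[Y]^GL (for Y GL-stable). *)
Definition invariant_on (Y : algstr K d -> Prop) (f : KU) : Prop :=
  forall (g : 'M[K]_d) x, g \in unitmx -> Y x ->
    peval f (gl_act g x) = peval f x.

Definition whole (x : algstr K d) : Prop := True.

(* The commutative polynomial algebra over K on the symbols p(n, s, n_1, .., n_r) *)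
Definition symalg := {malg K[{cmonom sym}]}.

Definition Xsym (s : sym) : symalg := << 1 *g ucm s >>.

Definition eval_monom (m : {cmonom sym}) : KU :=
  \prod_(s <- finsupp m) inv_poly s ^+ m s.

Fact eval_monom_mmorphism : mmorphism eval_monom.
Proof.
have widen (D : {fset sym}) (m : {cmonom sym}) : (finsupp m `<=` D)%fset ->
    eval_monom m = \prod_(s <- D) inv_poly s ^+ m s.
  move=> sD; rewrite /eval_monom; apply: big_fset_incl => // s _.
  by rewrite memNfinsupp => /eqP->; rewrite expr0.
split=> [m1 m2|]; last first.
  by rewrite /eval_monom big1 // => s _; rewrite onecmE expr0.
set D := (finsupp m1 `|` finsupp m2 `|` finsupp (mulcm m1 m2))%fset.
rewrite !(@widen D); first 1 last.
- by apply/fsubsetP=> s; rewrite !inE => ->; rewrite ?orbT.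
- by apply/fsubsetP=> s; rewrite !inE => ->; rewrite ?orbT.
- by apply/fsubsetP=> s; rewrite !inE => ->; rewrite ?orbT.
by rewrite -big_split; apply: eq_bigr => s _; rewrite mulcmE exprD.
Qed.

HB.instance Definition _ :=
  isMultiplicative.Build _ _ eval_monom eval_monom_mmorphism.

Definition eval_sym : symalg -> KU := monalg.mmap (@mpolyC _ K) eval_monom.

HB.instance Definition _ := GRing.RMorphism.on eval_sym.

Lemma eval_symX s : eval_sym (Xsym s) = inv_poly s.
Proof.
have sS : (finsupp (ucm s) `<=` [fset s])%fset.
  by apply/fsubsetP=> t; rewrite mem_finsupp ucmE inE [s == t]eq_sym; case: (t == s).
rewrite /eval_sym monalg.mmapU /= mpolyC1 mul1r /eval_monom.
rewrite (big_fset_incl _ sS) ?big_seq_fset1 ?ucmE ?eqxx ?expr1 // => t _.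
by rewrite memNfinsupp => /eqP->; rewrite expr0.
Qed.

Inductive ideal_gen (A : comNzRingType) (S : A -> Prop) : A -> Prop :=
| ideal_gen0 : ideal_gen S 0
| ideal_genD c a b : S a -> ideal_gen S b -> ideal_gen S (c * a + b).

Inductive relation (Y : algstr K d -> Prop) (E : KU -> symalg) :
    symalg -> Prop :=
| R0_mul (s t : sym) :
    relation Y E (Xsym s * Xsym t - Xsym (sym_mul s t))
| R0_one :
    relation Y E (Xsym (psym (1%g : 'S_(deg shape0))) - 1)
| R1 (u : shape) (s : 'S_(deg u)) (t : forall i, 'S_(val u i)) :
    relation Y E (Xsym (psym s) -
                  Xsym (psym (pcomp (pcomp (alpha_q t) s) (alpha_p t)^-1%g)))
| R2 (u : shape) (t1 t2 : 'S_(deg u)) : (d < deg u)%N ->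
    relation Y E
      (\sum_(s : 'S_(deg u) | perm_on [set i : 'I_(deg u) | (i <= d)%N] s)
          (-1) ^+ s *: Xsym (psym (pcomp (pcomp t1 s) t2)))
| R3 (f : KU) : vanishing_ideal Y f -> invariant_on whole f ->
    relation Y E (E f).

(* E chooses, for every f in I^GL, an expression of f as a polynomial in the
   basic invariants; R3 sets only this chosen expression to 0, so that the
   relations among basic invariants on all of U_d must come from R0, R1, R2. *)
Definition expressions (Y : algstr K d -> Prop) (E : KU -> symalg) : Prop :=
  forall f, vanishing_ideal Y f -> invariant_on whole f -> eval_sym (E f) = f.

End Presentation.
End Structures.

(* Main.v *)
From HB Require Import structures.
Require Import Defs.
From mathcomp Require Import all_boot all_order all_algebra all_fingroup finmap monalg mpoly.
From mathcomp Require Import ring.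
From Stdlib Require Import Classical.
Import GRing.Theory.
Local Open Scope ring_scope.

Set Implicit Arguments.
Unset Strict Implicit.
Unset Printing Implicit Defensive.

(* Relations.  By (R0) every polynomial in the symbols is congruent to a linear
   combination of symbols, and the multidegree separates the tuples
   (n_1, .., n_r).  For one tuple, averaging with (R1) over S_{n_1} x .. x S_{n_r}
   turns the vanishing of sum_s c_s Tr(L_s x_1^{n_1} .. x_r^{n_r}) into
   sum_s c_s L_s = 0.  The kernel of K[S_n] -> End(W^{(x)n}) is spanned by the
   translates of the antisymmetrizer of S_{d+1}: these rewrite a permutation with
   a decreasing subsequence of length d+1 into lexicographically smaller ones,
   while the L_s of the remaining permutations are triangular, hence independent.

   Generators.  A function invariant on Y is unchanged by any element of the group
   algebra of GL_d with coefficient sum 1, and polynomials extend it to U_d.  The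
   scalar matrices remove the monomials with sum p_i n_i <> sum q_i n_i.  On
   End(W^{(x)n}) such an element mapping everything to invariants exists over the
   rationals: it is the orthogonal projection of 1 on the complement of the span of
   the g - 1, because the action of GL_d(Q) is closed under transposition.  The
   double commutant theorem for S_n identifies the invariants with the span of the
   L_s, which are the coefficients of the basic invariants. *)

(** * Positions in a product of tensors *)

Lemma card_ord_lt n (y : 'I_n) : (\sum_(z < n) (z < y) = y)%N.
Proof.
rewrite -[RHS]card_ord -sum1_card (big_ord_widen n (fun=> 1%N) (ltnW (ltn_ord y))).
by rewrite [RHS]big_mkcond; apply: eq_bigr => z _; case: (z < y)%N.
Qed.

Lemma sum_Rank k (m : 'I_k -> nat) (F : 'I_(\sum_i m i) -> nat) :
  (\sum_x F x = \sum_i \sum_(z < m i) F (tagnat.Rank i z))%N.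
Proof.
rewrite (reindex _ (tagnat.rank_bij_on (p_ := m))) /= sig_big_dep /=.
by apply: eq_bigr => x _; rewrite tagnat.rankE.
Qed.

(** The image is the number of positions ordered before: the whole blocks moved ahead of c, and y
    positions of the block c itself. *)
Lemma Omega_Rank k (m : 'I_k -> nat) (s : 'S_k) (c : 'I_k) (y : 'I_(m c)) :
  Omega m s (tagnat.Rank c y) = (\sum_(c' | (s c' < s c)%N) m c' + y)%N :> nat.
Proof.
rewrite permE /= -sum1dep_card big_mkcond sum_Rank /=.
rewrite (bigD1 c) //= addnC; congr (_ + _)%N.
  rewrite [RHS]big_mkcond [RHS](bigD1 c) //= ltnn add0n.
  apply: eq_bigr => c' c'c; under eq_bigr => z _.
    rewrite /Omega_lt !tagnat.Rank1K (negPf c'c); over.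
  by case: ifP => _; rewrite sum_nat_const card_ord ?muln1 ?muln0.
rewrite -[RHS]card_ord_lt; apply: eq_bigr => z _.
rewrite /Omega_lt !tagnat.Rank1K eqxx -[(_ < _)%N]/(tagnat.Rank c z < tagnat.Rank c y)%O.
by rewrite tagnat.lt_Rank ltEord; case: (z < y)%N.
Qed.

Section Interleave.
Variables (r : nat) (m u v : 'I_r -> nat).

(** The block indices 2i and 2i+1 of n_i p_i and n'_i p_i, counted from 0; taken as preimages under
    [mu], so that their images are immediate. *)
Definition ev (i : 'I_r) : 'I_(r + r) := (mu r)^-1%g (lshift r i).
Definition od (i : 'I_r) : 'I_(r + r) := (mu r)^-1%g (rshift r i).

Lemma mu_ev i : mu r (ev i) = lshift r i. Proof. exact: permKV. Qed.
Lemma mu_od i : mu r (od i) = rshift r i. Proof. exact: permKV. Qed.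

Lemma evE i : ev i = i.*2 :> nat.
Proof.
have := congr1 val (mu_ev i); rewrite permE /mu_fun; case: ifP => o /= e.
  by have := ltn_ord i; rewrite -e ltnNge leq_addr.
by rewrite -e -[LHS]odd_double_half o.
Qed.

Lemma odE i : od i = i.*2.+1 :> nat.
Proof.
have := congr1 val (mu_od i); rewrite permE /mu_fun; case: ifP => o /= e.
  by rewrite -(addnI e) -[LHS]odd_double_half o.
by have := half_bound (od i); rewrite e ltnNge leq_addr.
Qed.

Lemma mu_blocks_ev i : mu_blocks m u v (ev i) = (m i * u i)%N.
Proof.
rewrite /mu_blocks (_ : half_ord _ = i) ?evE ?odd_double //.
by apply: val_inj; rewrite /= evE doubleK.
Qed.

Lemma mu_blocks_od i : mu_blocks m u v (od i) = (m i * v i)%N.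
Proof.
rewrite /mu_blocks (_ : half_ord _ = i) ?odE /= ?odd_double //.
by apply: val_inj; rewrite /= odE /= uphalf_double.
Qed.

Lemma sum_ev_od (P : pred 'I_(r + r)) (F : 'I_(r + r) -> nat) :
  (\sum_(c | P c) F c =
   \sum_(i | P (ev i)) F (ev i) + \sum_(i | P (od i)) F (od i))%N.
Proof.
rewrite big_mkcond (reindex_inj (@perm_inj _ (mu r)^-1%g)) big_split_ord /=.
by rewrite -!big_mkcond.
Qed.

(** [mu] puts the even blocks before the odd ones and keeps their order, so only even blocks of
    smaller index precede. The position x is given by its offset in the concatenation, the form
    delivered by [posE]. *)
Lemma Omega_mu_ev i (y : nat) (x : 'I_(\sum_c mu_blocks m u v c)) :
  (y < m i * u i)%N ->
  x = (\sum_(i' < r | (i' < i)%N) m i' * (u i' + v i') + y)%N :> nat ->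
  Omega _ (mu r) x = (\sum_(i' < r | (i' < i)%N) m i' * u i' + y)%N :> nat.
Proof.
rewrite -mu_blocks_ev => ly xE.
have -> : x = tagnat.Rank (ev i) (Ordinal ly).
  apply: ord_inj; rewrite xE tagnat.RankEsum sum_ev_od /=; congr (_ + _)%N.
  under [X in (X + _)%N]eq_bigl => i' do rewrite !evE ltn_double.
  under [X in (_ + X)%N]eq_bigl => i' do rewrite evE odE ltn_Sdouble.
  by rewrite -big_split; apply: eq_bigr => i' _; rewrite mu_blocks_ev mu_blocks_od mulnDr.
rewrite Omega_Rank sum_ev_od mu_ev /=; congr (_ + _)%N.
rewrite [X in (_ + X)%N]big1 ?addn0 => [|i']; last first.
  by rewrite mu_od /= ltnNge (leq_trans (ltnW (ltn_ord i))) ?leq_addr.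
by apply: eq_big => i'; rewrite ?mu_ev ?mu_blocks_ev.
Qed.

Lemma Omega_mu_od i (y : nat) (x : 'I_(\sum_c mu_blocks m u v c)) :
  (y < m i * v i)%N ->
  x = (\sum_(i' < r | (i' < i)%N) m i' * (u i' + v i') + (m i * u i + y))%N :> nat ->
  Omega _ (mu r) x =
    (\sum_i' m i' * u i' + (\sum_(i' < r | (i' < i)%N) m i' * v i' + y))%N :> nat.
Proof.
rewrite -mu_blocks_od => ly xE.
have -> : x = tagnat.Rank (od i) (Ordinal ly).
  apply: ord_inj; rewrite xE tagnat.RankEsum sum_ev_od /= addnA; congr (_ + _)%N.
  under [X in (_ = X + _)%N]eq_bigl => i' do rewrite evE odE ltnS leq_double.
  under [X in (_ = _ + X)%N]eq_bigl => i' do rewrite !odE ltnS ltn_double.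
  rewrite [X in (_ = X + _)%N](bigD1 i) //= mu_blocks_ev [LHS]addnC -addnA; congr (_ + _)%N.
  rewrite [X in (_ = X + _)%N](eq_bigl (fun i' : 'I_r => (i' < i)%N)) => [|i'];
    last by rewrite ltn_neqAle andbC.
  by rewrite -big_split; apply: eq_bigr => i' _; rewrite mu_blocks_ev mu_blocks_od mulnDr.
rewrite Omega_Rank sum_ev_od mu_od /= -addnA; congr (_ + (_ + _))%N.
  by apply: eq_big => i'; rewrite ?mu_ev ?mu_blocks_ev //= (leq_trans (ltn_ord i')) ?leq_addr.
by apply: eq_big => i'; rewrite ?mu_od ?mu_blocks_od //= ltn_add2l.
Qed.

End Interleave.

Section Positions.
Variables (r : nat) (m ns : 'I_r -> nat).

(** The place of the k-th index of the j-th copy of x_i in x_1^{(x)n_1} (x) .. (x) x_r^{(x)n_r}. *)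
Definition pos (i : 'I_r) (j : 'I_(ns i)) (k : 'I_(m i)) :
    'I_(\sum_i \sum_(j < ns i) m i) :=
  @tagnat.Rank r (fun i => (\sum_(j < ns i) m i)%N) i
    (@tagnat.Rank (ns i) (fun=> m i) j k).

Lemma posE i j k : @pos i j k =
  (\sum_(i' < r | (i' < i)%N) m i' * ns i' + (m i * j + k))%N :> nat.
Proof.
rewrite /pos !tagnat.RankEsum; congr (_ + (_ + _))%N.
  by apply: eq_bigr => i' _; rewrite sum_nat_const card_ord mulnC.
rewrite big_mkcond -[X in (_ * X)%N](card_ord_lt j) big_distrr /=.
by apply: eq_bigr => i' _; case: (i' < j)%N; rewrite ?muln1 ?muln0.
Qed.

Lemma pos_surj x : exists i j k, x = @pos i j k.
Proof.
exists (tagnat.sig1 x); set y := tagnat.sig2 x.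
exists (tagnat.sig1 y), (tagnat.sig2 y).
by rewrite /pos tagnat.sig2K tagnat.sig2K.
Qed.

Lemma alpha_pos (t : forall i, 'S_(ns i)) i j k :
  alpha m t (@pos i j k) = pos (t i j) k.
Proof.
rewrite permE /Pi_perm_fun /pos /tagnat.sig1 /tagnat.sig2 {1 2 3}/tagnat.Rank tagnat.rankK /=.
congr tagnat.Rank; apply: ord_inj.
rewrite Omega_Rank tagnat.RankEsum; congr (_ + _)%N.
rewrite big_mkcond [RHS]big_mkcond [RHS](reindex_inj (@perm_inj _ (t i))) /=.
by [].
Qed.

End Positions.

(** * Basic invariants and their relations *)

(** L_s has the entry 1 at (b, a) exactly when [msub b s = a], so traces and products with L_s
    become substitutions in multi-indices. *)
Definition msub d n n' (b : multi d n) (f : 'I_n' -> 'I_n) : multi d n' :=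
  [ffun j => b (f j)].

Lemma eq_msub d n n' (b : multi d n) (f g : 'I_n' -> 'I_n) :
  f =1 g -> msub b f = msub b g.
Proof. by move=> fg; apply/ffunP=> j; rewrite !ffunE fg. Qed.

Lemma msubA d n n' n'' (b : multi d n) (f : 'I_n' -> 'I_n) (g : 'I_n'' -> 'I_n') :
  msub (msub b f) g = msub b (f \o g).
Proof. by apply/ffunP=> j; rewrite !ffunE. Qed.

Lemma msub_id d n (b : multi d n) f : f =1 id -> msub b f = b.
Proof. by move=> fE; apply/ffunP=> j; rewrite ffunE fE. Qed.

Lemma msub_perm_inj d n (s : 'S_n) : injective (fun b : multi d n => msub b s).
Proof.
apply: (can_inj (g := fun b => msub b s^-1%g)) => b.
by rewrite msubA msub_id // => j; rewrite /= permKV.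
Qed.

Lemma reindex_msub (R : nmodType) d n (s : 'S_n) (F : multi d n -> R) :
  \sum_b F b = \sum_b F (msub b s).
Proof. exact: (reindex_inj (@msub_perm_inj d n s)). Qed.

(* Two of the first [d + 1] entries of [a] agree; multiplying by the
   transposition of their positions pairs the terms off with opposite signs. *)
Lemma alternating_msub (R : comNzRingType) d n (a : multi d n) (F : multi d n -> R) :
  (d < n)%N ->
  \sum_(s : 'S_n | perm_on [set i : 'I_n | (i <= d)%N] s) (-1) ^+ s * F (msub a s) = 0.
Proof.
move=> dn.
have [i [j [li lj ij aij]]] : exists i j : 'I_n,
    [/\ (i <= d)%N, (j <= d)%N, i != j & a i = a j].
  have /injectivePn[i [j ij aij]] : ~~ injectiveb (fun i : 'I_d.+1 => a (widen_ord dn i)).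
    by apply/injectiveP=> /leq_card; rewrite !card_ord ltnn.
  by exists (widen_ord dn i), (widen_ord dn j); split=> //; rewrite /= -ltnS.
have on_t : perm_on [set i : 'I_n | (i <= d)%N] (tperm i j).
  by apply: subset_trans (tperm_on i j) _; apply/subsetP=> k /set2P[]->; rewrite inE.
rewrite (bigID (fun s : 'S_n => odd_perm s)) /= addrC.
rewrite (reindex_inj (mulIg (tperm i j))) /=; apply/eqP; rewrite addr_eq0 -sumrN; apply/eqP.
apply: eq_big => s.
  rewrite odd_permM odd_tperm ij addbT negbK; congr (_ && _).
  apply/idP/idP => on_s; last exact: perm_onM.
  by rewrite -(mulgK (tperm i j) s) tpermV perm_onM.
rewrite odd_permM odd_tperm ij addbT negbK => /andP[_ ->] /=.
rewrite expr0 expr1 mul1r mulN1r opprK; congr F.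
apply/ffunP=> k; rewrite !ffunE !permM.
by case: tpermP => [->|->|].
Qed.

Section Distribution.
Variables (R : comNzRingType) (d k : nat) (m : 'I_k -> nat).

Lemma prod_Rank (F : 'I_(\sum_i m i) -> R) :
  \prod_x F x = \prod_i \prod_(z < m i) F (tagnat.Rank i z).
Proof.
rewrite (reindex _ (tagnat.rank_bij_on (p_ := m))) /= sig_big_dep /=.
by apply: eq_bigr => x _; rewrite tagnat.rankE.
Qed.

Lemma prod_sum_fprod (I : finType) (T : I -> finType) (F : forall i, T i -> R) :
  \prod_i \sum_(c : T i) F i c = \sum_(t : fprod T) \prod_i F i (t i).
Proof.
pose G i : {ffun T i -> R} := [ffun c => F i c].
transitivity (\sum_(t : fprod T) \prod_(i in I) G i (t i)); last first.
  by apply: eq_bigr => t _; apply: eq_bigr => i _; rewrite ffunE.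
under eq_bigr => i _ do rewrite (big_tag (fun i => F i)).
rewrite (big_fprod _ _ G) bigA_distr_big_dep.
apply: eq_big => // t /familyP tT; apply: eq_bigr => i _.
by have /eqP ti := tT i; rewrite !untagE ffunE.
Qed.

Lemma glue_blocksP (t : forall i, multi d (m i)) :
  {c : multi d (\sum_i m i) | forall i, block_index c i = t i}.
Proof.
exists [ffun x => t (tagnat.sig1 x) (tagnat.sig2 x)] => i; apply/ffunP=> z.
by rewrite !ffunE /tagnat.sig1 /tagnat.sig2 /tagnat.Rank tagnat.rankK.
Qed.

Lemma prod_sum_blocks (F : forall i, multi d (m i) -> R) :
  \prod_i \sum_c F i c = \sum_c \prod_i F i (block_index c i).
Proof.
rewrite (prod_sum_fprod F).
pose h (c : multi d (\sum_i m i)) : fprod (fun i => multi d (m i)) :=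
  [fprod i => block_index c i].
rewrite (reindex h).
  by apply: eq_bigr => c _; apply: eq_bigr => i _; rewrite fprodE.
exists (fun t : fprod (fun i => multi d (m i)) => sval (glue_blocksP (fun i => t i))) => [c _|t _].
  apply/ffunP=> x; rewrite -[x]tagnat.sig2K.
  have /ffunP/(_ (tagnat.sig2 x)) := svalP (glue_blocksP (fun i => h c i)) (tagnat.sig1 x).
  by rewrite fprodE !ffunE.
by apply/fprodP=> i; rewrite fprodE (svalP (glue_blocksP (fun i => t i))).
Qed.

End Distribution.

Section Tensors.
Variable d : nat.

Lemma tactE (R : comUnitRingType) (g : 'M[R]_d) p q (x : tensor R d p q) b a :
  tact g x (b, a) = \sum_(c : multi d p) \sum_(c' : multi d q)
    tpow g p (b, c) * x (c, c') * tpow (invmx g) q (c', a).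
Proof.
rewrite exchange_big ffunE; apply: eq_bigr => c' _.
by rewrite ffunE big_distrl.
Qed.

Lemma tpow_mul (R : comNzRingType) (g h : 'M[R]_d) n b c :
  \sum_(a : multi d n) tpow g n (b, a) * tpow h n (a, c) = tpow (g *m h) n (b, c).
Proof.
rewrite ffunE; under [RHS]eq_bigr do rewrite mxE.
by rewrite bigA_distr_bigA; apply: eq_bigr => a _; rewrite !ffunE -big_split.
Qed.

Lemma tpow1 (R : comNzRingType) n (b a : multi d n) :
  tpow (1%:M : 'M[R]_d) n (b, a) = (b == a)%:R.
Proof.
rewrite ffunE /=; case: eqP => [->|ab].
  by rewrite big1 // => j _; rewrite mxE eqxx.
have [j bj] : exists j, b j != a j.
  by apply/existsP; apply: contra_notT ab => /existsPn ab; apply/ffunP=> j; apply/eqP/negPn.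
by rewrite (bigD1 j) //= mxE (negPf bj) mul0r.
Qed.

Lemma tpow_msub (R : comNzRingType) (g : 'M[R]_d) n (s : 'S_n) b a :
  tpow g n (msub b s, msub a s) = tpow g n (b, a).
Proof.
rewrite !ffunE [RHS](reindex_inj (@perm_inj _ s)).
by apply: eq_bigr => j _; rewrite !ffunE.
Qed.

Lemma tprod_act (R : comUnitRingType) (g : 'M[R]_d) k (m l : 'I_k -> nat)
    (x : forall i, tensor R d (m i) (l i)) :
  tprod (fun i => tact g (x i)) = tact g (tprod x).
Proof.
apply/ffunP=> -[b a]; rewrite ffunE tactE /=.
under eq_bigr do rewrite tactE.
rewrite (prod_sum_blocks (fun i c => \sum_(c' : multi d (l i)) tpow g (m i) (block_index b i, c)
  * x i (c, c') * tpow (invmx g) (l i) (c', block_index a i))).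
apply: eq_bigr => c _.
rewrite (prod_sum_blocks (fun i c' => tpow g (m i) (block_index b i, block_index c i)
  * x i (block_index c i, c') * tpow (invmx g) (l i) (c', block_index a i))).
apply: eq_bigr => c' _; rewrite !big_split /= !ffunE !prod_Rank /=.
by congr (_ * _ * _); apply: eq_bigr => i _; rewrite ffunE; apply: eq_bigr => j _; rewrite !ffunE.
Qed.

Lemma tcast_act (R : comUnitRingType) (g : 'M[R]_d) p p' q q' (ep : p = p') (eq : q = q')
    (x : tensor R d p q) :
  Defs.tcast ep eq (tact g x) = tact g (Defs.tcast ep eq x).
Proof.
case: p' / ep; case: q' / eq.
suff tcast_id y : Defs.tcast (erefl p) (erefl q) y = y :> tensor R d p q by rewrite !tcast_id.
apply/ffunP=> -[b a]; rewrite ffunE; congr (y (_, _));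
  by apply/ffunP=> j; rewrite ffunE cast_ord_id.
Qed.

End Tensors.

Section BasicInvariants.
Variables (r : nat) (p q : 'I_r -> nat) (d : nat).
Implicit Types u v : Defs.shape p q.

Definition posP u i (j : 'I_(val u i)) (k : 'I_(p i)) : 'I_(deg u) :=
  cast_ord (deg_out u) (pos j k).
Definition posQ u i (j : 'I_(val u i)) (k : 'I_(q i)) : 'I_(deg u) :=
  cast_ord (deg_in u) (pos j k).

Lemma alpha_posP u t i (j : 'I_(val u i)) k :
  alpha_p t (posP j k) = posP (t i j) k.
Proof. by rewrite cast_permE cast_ordK alpha_pos. Qed.

Lemma alpha_posQ u t i (j : 'I_(val u i)) k :
  alpha_q t (posQ j k) = posQ (t i j) k.
Proof. by rewrite cast_permE cast_ordK alpha_pos. Qed.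

Section Ring.
Variables (R : comNzRingType) (x : algstr p q R d).

Lemma tmonomialE u b a : tmonomial x u (b, a) =
  \prod_i \prod_(j < val u i) x i (msub b (@posP u i j), msub a (@posQ u i j)).
Proof.
rewrite !ffunE; apply: eq_bigr => i _; rewrite ffunE; apply: eq_bigr => j _.
by congr (x i (_, _)); apply/ffunP=> l; rewrite !ffunE.
Qed.

Lemma basic_invE u s :
  basic_inv x (psym s) = \sum_a tmonomial x u (msub a s, a).
Proof.
apply: eq_bigr => a _; rewrite ffunE /= (bigD1 (msub a s)) //=.
rewrite big1 ?addr0 => [|c /eqP ac]; rewrite [Lperm _ _ _ _]ffunE /=; case: forallP.
- by rewrite mul1r.
- by case=> j; rewrite ffunE.
- by move=> asc; case: ac; apply/ffunP=> j; rewrite ffunE (eqP (asc j)).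
by rewrite mul0r.
Qed.

Lemma tmonomial_alpha u t b a :
  tmonomial x u (msub b (alpha_p t), msub a (alpha_q t)) = tmonomial x u (b, a).
Proof.
rewrite !tmonomialE; apply: eq_bigr => i _.
rewrite [RHS](reindex_inj (@perm_inj _ (t i))); apply: eq_bigr => j _.
congr (x i (_, _)); apply/ffunP=> k; rewrite !ffunE.
  by rewrite alpha_posP.
by rewrite alpha_posQ.
Qed.

Lemma basic_inv_R1 u (s : 'S_(deg u)) (t : forall i, 'S_(val u i)) :
  basic_inv x (psym s) =
  basic_inv x (psym (Defs.pcomp (Defs.pcomp (alpha_q t) s) (alpha_p t)^-1%g)).
Proof.
rewrite !basic_invE [RHS](reindex_msub (alpha_q t)^-1%g); apply: eq_bigr => a _.
rewrite -[RHS](tmonomial_alpha t) !msubA; congr (tmonomial x u (_, _)).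
  by apply: eq_msub => j; rewrite /= !permM !permK.
by rewrite msub_id // => j; rewrite /= permK.
Qed.

Lemma basic_inv_R0_one : basic_inv x (psym (1%g : 'S_(deg (@shape0 r p q)))) = 1.
Proof.
rewrite basic_invE.
have d0 : deg (@shape0 r p q) = 0%N by rewrite /deg big1 // => i _; rewrite ffunE muln0.
rewrite (eq_bigr (fun=> 1)) => [|a _]; last first.
  rewrite tmonomialE big1 // => i _; rewrite big1 // => -[j lj].
  by exfalso; move: lj; rewrite ffunE.
by rewrite sumr_const card_ffun card_ord [#|_|]card_ord d0.
Qed.

Lemma basic_inv_R2 u (t1 t2 : 'S_(deg u)) : (d < deg u)%N ->
  \sum_(s : 'S_(deg u) | perm_on [set i : 'I_(deg u) | (i <= d)%N] s)
     (-1) ^+ s * basic_inv x (psym (Defs.pcomp (Defs.pcomp t1 s) t2)) = 0.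
Proof.
(* Substituting [t1^-1] in the trace index lets s act directly on a, as [alternating_msub]
   requires. *)
move=> du; under eq_bigr => s _.
  rewrite basic_invE (reindex_msub t1^-1%g) big_distrr /=; over.
rewrite exchange_big big1 // => a _ /=.
rewrite -[RHS](alternating_msub a (fun b => tmonomial x u (msub b t2, msub a t1^-1%g)) du).
apply: eq_bigr => s _; congr (_ * tmonomial x u (_, _)).
by rewrite !msubA; apply: eq_msub => j; rewrite /= !permM permK.
Qed.

End Ring.

Lemma tmonomial_act (R : comUnitRingType) (g : 'M[R]_d) (x : algstr p q R d) u :
  tmonomial (gl_act g x) u = tact g (tmonomial x u).
Proof.
rewrite /tmonomial -tcast_act; congr Defs.tcast; rewrite -tprod_act.
apply/ffunP=> ba; rewrite !ffunE; apply: eq_bigr => i _.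
by rewrite -tprod_act !ffunE; apply: eq_bigr => j _; rewrite ffunE.
Qed.

(** The operator g^{(x)n} commutes with L_s, so under the trace it cancels against its inverse. *)
Lemma basic_inv_act (R : comUnitRingType) (g : 'M[R]_d) (x : algstr p q R d) s :
  g \in unitmx -> basic_inv (gl_act g x) s = basic_inv x s.
Proof.
case: s => u s gu; rewrite !basic_invE.
under eq_bigr => a _ do rewrite tmonomial_act tactE.
transitivity (\sum_(c : multi d (deg u)) \sum_(c' : multi d (deg u))
    tmonomial x u (c, c') * \sum_(a : multi d (deg u))
      tpow (invmx g) (deg u) (msub c' s, msub a s) * tpow g (deg u) (msub a s, c)).
  rewrite exchange_big; apply: eq_bigr => c _; rewrite exchange_big /=.
  apply: eq_bigr => c' _; rewrite big_distrr /=; apply: eq_bigr => a _.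
  rewrite tpow_msub; ring.
under eq_bigr => c _ do under eq_bigr => c' _ do
  rewrite -(reindex_msub s (fun a => tpow _ _ (_, a) * tpow _ _ (a, _))) tpow_mul mulVmx // tpow1.
rewrite exchange_big; apply: eq_bigr => c' _ /=.
rewrite (bigD1 (msub c' s)) //= eqxx mulr1 big1 ?addr0 // => c.
by rewrite eq_sym => /negPf->; rewrite mulr0.
Qed.

End BasicInvariants.

(** * The kernel of the symmetric group algebra *)

Section LexicographicOrder.
Variable n : nat.
Implicit Types s t : 'S_n.

Definition plt s t :=
  [exists j : 'I_n, [forall i : 'I_n, (i < j)%N ==> (s i == t i)] && (s j < t j)%N].

Lemma pltP s t :
  reflect (exists2 j : 'I_n, forall i : 'I_n, (i < j)%N -> s i = t i & (s j < t j)%N)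
          (plt s t).
Proof.
apply: (iffP existsP) => [[j /andP[/forallP st lt]]|[j st lt]]; exists j => //.
  by move=> i ij; have /implyP/(_ ij)/eqP := st i.
by rewrite lt andbT; apply/forallP=> i; apply/implyP=> /st->.
Qed.

Lemma plt_irr : irreflexive plt.
Proof. by move=> s; apply/pltP=> -[j _]; rewrite ltnn. Qed.

Lemma plt_trans : transitive plt.
Proof.
move=> t s u /pltP[j st ltj] /pltP[k tu ltk]; apply/pltP.
case: (ltngtP j k) => [jk|kj|/val_inj jk].
- by exists j => [i ij|]; rewrite -?(tu _ jk) // st // tu // (ltn_trans ij).
- by exists k => [i ik|]; rewrite ?(st _ kj) // -tu // st // (ltn_trans ik).
- by exists j => [i ij|]; [rewrite st // tu // -jk | rewrite (ltn_trans ltj) // jk].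
Qed.

Definition plt_rank s := #|[set t | plt t s]|.

Lemma plt_rankP s t : plt s t -> (plt_rank s < plt_rank t)%N.
Proof.
move=> st; apply: proper_card; apply/properP; split.
  by apply/subsetP=> w; rewrite !inE => /plt_trans; apply.
by exists s; rewrite inE ?st // plt_irr.
Qed.

(** The values below the first moved position j are taken by fixed points, so j can only move up. *)
Lemma first_moved s : s != 1%g ->
  exists2 j : 'I_n, forall i : 'I_n, (i < j)%N -> s i = i & (j < s j)%N.
Proof.
move=> s1.
have [k0 k0P] : exists k0, s k0 != k0.
  apply/existsP; apply: contraR s1 => /existsPn s1; apply/eqP/permP=> k.
  by rewrite perm1; apply/eqP/negPn.
case: (arg_minnP (P := fun j => s j != j) (fun j : 'I_n => j : nat) k0P) => j sj minj.
have fix_lt (i : 'I_n) : (i < j)%N -> s i = i.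
  by move=> ij; apply/eqP/negPn/negP=> /minj; rewrite leqNgt ij.
exists j => //; case: (ltngtP (s j) j) => // [/fix_lt/perm_inj/eqP|/val_inj/eqP].
  by rewrite (negPf sj).
by rewrite (negPf sj).
Qed.

End LexicographicOrder.

(** * Straightening of permutations with long decreasing subsequences *)

Section DecreasingSubsequences.
Variables (d n : nat).
Implicit Types s t : 'S_n.

Definition decreasing s (D : {set 'I_n}) :=
  [forall i in D, forall j in D, (i < j)%N ==> (s j < s i)%N].

Lemma decreasingP s (D : {set 'I_n}) :
  reflect {in D &, forall i j : 'I_n, (i < j)%N -> (s j < s i)%N} (decreasing s D).
Proof.
apply: (iffP forall_inP) => [dec i j iD jD|dec i iD].
  by have /forall_inP/(_ j jD)/implyP := dec i iD.
by apply/forall_inP=> j jD; apply/implyP; apply: dec.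
Qed.

Definition good s := [forall D : {set 'I_n}, decreasing s D ==> (#|D| <= d)%N].

(* Colour a position by the length of the longest decreasing subsequence
   ending there: each colour class is then increasing. *)
Lemma good_coloring s : good s ->
  exists a : multi d n, forall i j : 'I_n, (i < j)%N -> a i = a j -> (s i < s j)%N.
Proof.
move=> /forallP gs.
pose ends i (D : {set 'I_n}) :=
  [&& decreasing s D, i \in D & [forall j in D, (j <= i)%N]].
pose f i := (\max_(D | ends i D) #|D|)%N.
have ends1 i : ends i [set i].
  rewrite /ends set11 /=; apply/andP; split.
    by apply/decreasingP=> j k /set1P-> /set1P->; rewrite ltnn.
  by apply/forall_inP=> j /set1P->.
have f_gt0 i : (0 < f i)%N.
  by rewrite -(cards1 i); apply: (bigmax_sup [set i]).
have f_le i : ((f i).-1 < d)%N.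
  rewrite prednK //; apply/bigmax_leqP=> D /and3P[dD _ _].
  by have /implyP/(_ dD) := gs D.
exists [ffun i => Ordinal (f_le i)] => i j ij; rewrite !ffunE => -[fij].
case: (ltngtP (s i) (s j)) => // [ji|/val_inj/perm_inj ji]; last by rewrite ji ltnn in ij.
(* If s j < s i, a longest decreasing subsequence ending at i extends by j, so the colours
   differ. *)
suff: (f i < f j)%N.
  by rewrite -[f i]prednK // -[f j]prednK // fij ltnn.
have [|D endsD fD] := @eq_bigmax_cond _ (ends i) (fun D : {set 'I_n} => #|D|).
  by apply/card_gt0P; exists [set i]; apply: ends1.
rewrite [f i]fD; move: endsD; rewrite unfold_in => endsD.
case/and3P: endsD => /decreasingP dD iD /forall_inP leD.
have jD : j \notin D by apply/negP=> /leD; rewrite leqNgt ij.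
have -> : #|D|.+1 = #|j |: D| by rewrite cardsU1 jD.
apply: (bigmax_sup (j |: D)) => //; apply/and3P; split.
- apply/decreasingP=> k l /setU1P[->|kD] /setU1P[->|lD]; rewrite ?ltnn //.
  + by move=> jl; have := leq_trans jl (leD l lD); rewrite ltnNge ltnW.
  + move=> _; apply: (leq_trans ji); have := leD k kD.
    by rewrite leq_eqVlt => /orP[/eqP/val_inj->//|/(dD _ _ kD iD)/ltnW].
  + exact: dD.
- exact: setU11.
- by apply/forall_inP=> k /setU1P[->//|/leD ki]; rewrite (leq_trans ki) // ltnW.
Qed.

(** Take s lexicographically largest in the support and a colouring a of it. Any other t
    contributing to the entry ([msub a s^-1], a) moves positions within their colour relative to s;
    s increases on each colour, so t exceeds s at the first place where they differ. *)
Lemma good_independent (R : nzRingType) (c : 'S_n -> R) :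
  (forall s, ~~ good s -> c s = 0) ->
  (forall b a : multi d n, \sum_(s : 'S_n | msub b s == a) c s = 0) ->
  forall s, c s = 0.
Proof.
move=> c_good c_0 s; apply/eqP/negPn/negP=> cs.
case: (arg_maxnP (P := fun s => c s != 0) (@plt_rank n) cs) => {}s {}cs maxs.
have gs : good s by apply: contraNT cs => /c_good->.
have [a aP] := good_coloring gs.
move: (c_0 (msub a s^-1%g) a) => /eqP; apply/negP; rewrite (bigD1 s) /=; last first.
  by rewrite msubA msub_id // => j; rewrite /= permK.
rewrite big1 ?addr0 // => t /andP[/eqP at_a ts]; apply/eqP/negPn/negP=> /maxs /=.
apply/negP; rewrite -ltnNge; apply: plt_rankP; apply/pltP.
have /first_moved[j fixj ltj] : (t * s^-1)%g != 1%g by rewrite -eq_mulgV1.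
exists j => [i /fixj|]; first by rewrite permM => /(canRL (permKV s)).
have := aP _ _ ltj; rewrite permM permKV; apply.
by rewrite -[in LHS]at_a !ffunE.
Qed.

Lemma perm_to_set (D : {set 'I_n}) : (d < #|D|)%N ->
  exists t : 'S_n, forall i : 'I_n, (i <= d)%N -> t i \in D.
Proof.
move=> dD; pose e := enum D ++ enum (~: D).
have size_e : size e = n by rewrite size_cat -!cardE cardsC card_ord.
have uniq_e : uniq e.
  rewrite cat_uniq !enum_uniq /= andbT; apply/hasPn=> x.
  by rewrite !mem_enum inE.
have /card_gt0P[x0 _] : (0 < #|D|)%N by apply: leq_ltn_trans dD.
have inj_e : injective (fun i : 'I_n => nth x0 e i).
  by move=> i j /eqP; rewrite nth_uniq ?size_e // => /eqP/val_inj.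
exists (perm inj_e) => i id; rewrite permE nth_cat -cardE.
by rewrite (leq_ltn_trans id dD) -mem_enum mem_nth // -cardE (leq_ltn_trans id dD).
Qed.

Section Straightening.
Variables (R : comNzRingType) (V : lmodType R) (X : 'S_n -> V) (W : V -> Prop).
Hypothesis W0 : W 0.
Hypothesis WD : forall c u v, W u -> W v -> W (c *: u + v).
Hypothesis W_R2 : forall t1 t2 : 'S_n, (d < n)%N ->
  W (\sum_(s | perm_on [set i : 'I_n | (i <= d)%N] s)
       (-1) ^+ s *: X (Defs.pcomp (Defs.pcomp t1 s) t2)).

Lemma W_sum (I : finType) (P : pred I) (c : I -> R) (F : I -> V) :
  (forall i, P i -> W (F i)) -> W (\sum_(i | P i) c i *: F i).
Proof.
move=> WF; apply: (big_ind W) => // [u v Wu Wv|i /WF WFi].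
  by rewrite -[u]scale1r; apply: WD.
by rewrite -[_ *: _]addr0; apply: WD.
Qed.

(** [W] is any submodule containing the dimension relations. If s decreases on more than d positions
    D, such a relation moved onto D writes X s through the X (z^t s) with z <> 1. The first position
    moved by z^t receives the value of s at a later position of D, which is smaller, so the
    induction is lexicographic. *)
Lemma straighten s : exists c : 'S_n -> R,
  (forall t, ~~ good t -> c t = 0) /\ W (X s - \sum_t c t *: X t).
Proof.
have [k] := ubnP (plt_rank s); elim: k s => // k IH s /ltnSE rk_s.
have [gs|/forallPn[D]] := boolP (good s).
  exists (fun t => (t == s)%:R); split=> [t|].
    by case: eqP => [->|//]; rewrite gs.
  rewrite (bigD1 s) //= eqxx scale1r big1 ?addr0 ?subrr // => t /negPf->.
  by rewrite scale0r.
rewrite negb_imply -ltnNge => /andP[/decreasingP dD cD].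
have dn : (d < n)%N by rewrite (leq_trans cD) // -[X in (_ <= X)%N]card_ord max_card.
have [t tP] := perm_to_set cD.
pose w (z : 'S_n) := (z ^ t * s)%g.
have lt_w z : perm_on [set i : 'I_n | (i <= d)%N] z -> z != 1%g -> plt (w z) s.
  move=> on_z z1.
  have /first_moved[j fixj ltj] : (z ^ t)%g != 1%g by rewrite conjg_eq1.
  apply/pltP; exists j => [i /fixj zi|]; first by rewrite permM zi.
  rewrite permM; have inD i : (z ^ t)%g i != i -> i \in D.
    rewrite -[i](permKV t) permJ (inj_eq perm_inj) => zi.
    by rewrite tP //; have /subsetP/(_ _ zi) := on_z; rewrite inE.
  apply: (dD) => //; apply: inD; last by rewrite (inj_eq perm_inj) eq_sym -val_eqE neq_ltn ltj.
  by rewrite -val_eqE neq_ltn ltj orbT.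
have /fin_all_exists[c cP] z : exists c : 'S_n -> R,
    perm_on [set i : 'I_n | (i <= d)%N] z -> z != 1%g ->
    (forall t, ~~ good t -> c t = 0) /\ W (X (w z) - \sum_t c t *: X t).
  have [/andP[on_z z1]|nz] := boolP (perm_on [set i : 'I_n | (i <= d)%N] z && (z != 1%g)).
    have [|c cP] := IH (w z); last by exists c.
    exact: leq_trans (plt_rankP (lt_w _ on_z z1)) rk_s.
  by exists (fun=> 0) => on_z z1; rewrite on_z z1 in nz.
(* With these translations the term of z is X ([w z]) and the term of 1 is X s. *)
have := W_R2 (t * s)%g t^-1%g dn.
rewrite (bigD1 1%g) /= ?perm_on1 // odd_perm1 expr0 scale1r => WX.
pose c' t0 := - \sum_(z : 'S_n | perm_on [set i : 'I_n | (i <= d)%N] z && (z != 1%g))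
  (-1) ^+ z * c z t0.
exists c'.
split=> [t0 bad|].
  by rewrite /c' big1 ?oppr0 // => z /andP[on_z z1]; have [-> //] := cP z on_z z1; rewrite mulr0.
have {}cP : W (\sum_(z : 'S_n | perm_on [set i : 'I_n | (i <= d)%N] z && (z != 1%g))
    (-1) ^+ z *: (X (w z) - \sum_t0 c z t0 *: X t0)).
  by apply: W_sum => z /andP[on_z z1]; have [] := cP z on_z z1.
have := WD (-1) cP WX; congr W; rewrite scaleN1r.
have -> : Defs.pcomp (Defs.pcomp (t * s)%g 1%g) t^-1%g = s by rewrite /Defs.pcomp mul1g mulKg.
have -> : \sum_t0 c' t0 *: X t0 =
    - \sum_(z : 'S_n | perm_on [set i : 'I_n | (i <= d)%N] z && (z != 1%g))
        (-1) ^+ z *: \sum_t0 c z t0 *: X t0.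
  under eq_bigr => t0 _ do rewrite scaleNr scaler_suml.
  rewrite sumrN exchange_big; congr (- _); apply: eq_bigr => z _.
  by rewrite scaler_sumr; apply: eq_bigr => t0 _; rewrite scalerA.
rewrite opprK [LHS]addrC -[LHS]addrA; congr (_ + _); rewrite -sumrB; apply: eq_bigr => z _.
have -> : Defs.pcomp (Defs.pcomp (t * s)%g z) t^-1%g = w z.
  by rewrite /w /Defs.pcomp conjgE !mulgA.
by rewrite scalerBr opprB addrC subrK.
Qed.

End Straightening.

(* The kernel of [R[S_n] -> End(W^{(x)n})] is spanned by the translates of the
   antisymmetrizer of S_{d+1}: apply [straighten] to the pairs
   [(X s, matrix of L_s)]. *)
Lemma second_fundamental_perm (R : comNzRingType) (V : lmodType R)
    (X : 'S_n -> V) (W : V -> Prop) (c : 'S_n -> R) :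
  W 0 -> (forall c u v, W u -> W v -> W (c *: u + v)) ->
  (forall t1 t2 : 'S_n, (d < n)%N ->
    W (\sum_(s | perm_on [set i : 'I_n | (i <= d)%N] s)
         (-1) ^+ s *: X (Defs.pcomp (Defs.pcomp t1 s) t2))) ->
  (forall b a : multi d n, \sum_(s : 'S_n | msub b s == a) c s = 0) ->
  W (\sum_s c s *: X s).
Proof.
move=> W0 WD W_R2 c0.
pose M := {ffun multi d n * multi d n -> R^o}.
pose X' (s : 'S_n) : (V * M)%type := (X s, [ffun ba => (msub ba.1 s == ba.2)%:R]).
(* Demanding that the matrix component vanish makes the straightening coefficients valid for the L_s
   too. *)
pose W' (v : V * M) := W v.1 /\ v.2 = 0.
have /fin_all_exists[e eP] s : exists e : 'S_n -> R,
    (forall t, ~~ good t -> e t = 0) /\ W' (X' s - \sum_t e t *: X' t).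
  apply: straighten => [|k u v [Wu u0] [Wv v0]|t1 t2 dn]; first by [].
    by split; [exact: WD|rewrite /= u0 v0 scaler0 addr0].
  split; first by rewrite raddf_sum; apply: W_R2.
  rewrite raddf_sum; apply/ffunP=> -[b a] /=; rewrite sum_ffunE ffunE.
  rewrite -[RHS](alternating_msub (msub b t1) (fun b' => (msub b' t2 == a)%:R) dn).
  apply: eq_bigr => z _; rewrite !ffunE /=; congr (_ * (_ == a)%:R).
  by rewrite !msubA; apply: eq_msub => j; rewrite /= !permM.
have W_c : W (\sum_s c s *: (X s - \sum_t e s t *: X t)).
  apply: W_sum => // s _; have [_ [We _]] := eP s.
  by move: We; rewrite /= raddf_sum.
(* The coefficients after straightening live on good permutations and still annihilate the L_s,
   hence vanish. *)
pose c' t := \sum_s c s * e s t.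
have c'0 : forall t, c' t = 0.
  apply: good_independent => [t bad|b a].
    by rewrite /c' big1 // => s _; have [-> //] := eP s; rewrite mulr0.
  rewrite exchange_big -[RHS](c0 b a) [RHS]big_mkcond; apply: eq_bigr => s _.
  have [_ [_ /ffunP/(_ (b, a))]] := eP s.
  rewrite /= raddf_sum !ffunE sum_ffunE => /eqP.
  rewrite subr_eq0 => /eqP Le; rewrite -big_distrr /=.
  transitivity (c s * (msub b s == a)%:R); last by case: eqP; rewrite ?mulr1 ?mulr0.
  rewrite Le big_mkcond; congr (_ * _); apply: eq_bigr => t _.
  by rewrite /= !ffunE /=; case: eqP => _; [rewrite -[RHS]/(_ * _) mulr1 | rewrite scaler0].
have -> : \sum_s c s *: X s =
    \sum_s c s *: (X s - \sum_t e s t *: X t) + \sum_t c' t *: X t.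
  under [X in _ + X]eq_bigr => t _ do rewrite scaler_suml.
  rewrite exchange_big -big_split; apply: eq_bigr => s _ /=.
  under [X in _ + X]eq_bigr => t _ do rewrite -scalerA.
  by rewrite -scaler_sumr -scalerDr subrK.
by rewrite [X in _ + X]big1 ?addr0 // => t _; rewrite c'0 scale0r.
Qed.

End DecreasingSubsequences.

(** * Products of basic invariants *)

Section Product.
Variables (r : nat) (p q : 'I_r -> nat) (d : nat).
Implicit Types u v : Defs.shape p q.

Fact val_shape_add u v i : val (shape_add u v) i = (val u i + val v i)%N.
Proof. by rewrite ffunE. Qed.

Definition lidx u v i (j : 'I_(val u i)) : 'I_(val (shape_add u v) i) :=
  cast_ord (esym (val_shape_add u v i)) (lshift (val v i) j).
Definition ridx u v i (j : 'I_(val v i)) : 'I_(val (shape_add u v) i) :=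
  cast_ord (esym (val_shape_add u v i)) (rshift (val u i) j).

Lemma block_bound n m (j : 'I_n) (k : 'I_m) : (m * j + k < m * n)%N.
Proof. by rewrite (@leq_trans (m * j.+1)) ?leq_mul2l ?ltn_ord ?orbT // mulnS addnC ltn_add2r. Qed.

Definition unadd u v : 'I_(deg (shape_add u v)) -> 'I_(deg u + deg v) :=
  cast_ord (esym (deg_add u v)).

Lemma posPE u i (j : 'I_(val u i)) (k : 'I_(p i)) : posP j k =
  (\sum_(i' < r | (i' < i)%N) p i' * val u i' + (p i * j + k))%N :> nat.
Proof. exact: posE. Qed.

Lemma posQE u i (j : 'I_(val u i)) (k : 'I_(q i)) : posQ j k =
  (\sum_(i' < r | (i' < i)%N) q i' * val u i' + (q i * j + k))%N :> nat.
Proof. exact: posE. Qed.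

(** Among the n_i + n'_i copies of x_i the first n_i belong to the first factor; [mu1] and [mu2]
    send these to the first [deg u] positions and the others behind them. *)
Lemma mu1_l u v i j (k : 'I_(p i)) :
  mu1 u v (unadd (posP (@lidx u v i j) k)) = lshift (deg v) (posP j k).
Proof.
apply: ord_inj; rewrite cast_permE.
apply: etrans (esym (posPE j k)); apply: Omega_mu_ev.
  exact: block_bound.
apply: etrans (posPE _ _) _; congr (_ + _)%N.
by apply: eq_bigr => i' _; rewrite ffunE.
Qed.

Lemma mu2_l u v i j (k : 'I_(q i)) :
  mu2 u v (unadd (posQ (@lidx u v i j) k)) = lshift (deg v) (posQ j k).
Proof.
apply: ord_inj; rewrite cast_permE.
apply: etrans (esym (posQE j k)); apply: Omega_mu_ev.
  exact: block_bound.
apply: etrans (posQE _ _) _; congr (_ + _)%N.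
by apply: eq_bigr => i' _; rewrite ffunE.
Qed.

Lemma mu1_r u v i j (k : 'I_(p i)) :
  mu1 u v (unadd (posP (@ridx u v i j) k)) = rshift (deg u) (posP j k).
Proof.
apply: ord_inj; rewrite cast_permE.
apply: etrans _ (congr1 (addn (deg u)) (esym (posPE j k))); apply: Omega_mu_od.
  exact: block_bound.
apply: etrans (posPE _ _) _; rewrite mulnDr -addnA; congr (_ + _)%N.
by apply: eq_bigr => i' _; rewrite ffunE.
Qed.

Lemma mu2_r u v i j (k : 'I_(q i)) :
  mu2 u v (unadd (posQ (@ridx u v i j) k)) = rshift (deg u) (posQ j k).
Proof.
apply: ord_inj; rewrite cast_permE.
apply: etrans _ (congr1 (addn (deg u)) (esym (posQE j k))).
(* [deg u] is defined through p; the balance of u turns it into the sum with q. *)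
apply: etrans _ (congr1 (addn^~ _) (esym (eqP (valP u)))); apply: Omega_mu_od.
  exact: block_bound.
apply: etrans (posQE _ _) _; rewrite mulnDr -addnA; congr (_ + _)%N.
by apply: eq_bigr => i' _; rewrite ffunE.
Qed.

Section Ring.
Variables (R : comNzRingType) (x : algstr p q R d).

(** The entry (b, a) of M_u (x) M_v = L_mu1 M_{u+v} L_{mu2^-1}, where M denotes the tensor
    monomials. *)
Lemma tmonomial_add u v (b a : multi d (deg u + deg v)) :
  tmonomial x (shape_add u v)
    (msub b (mu1 u v \o @unadd u v), msub a (mu2 u v \o @unadd u v)) =
  tmonomial x u (msub b (lshift (deg v)), msub a (lshift (deg v))) *
  tmonomial x v (msub b (@rshift (deg u) (deg v)), msub a (@rshift (deg u) (deg v))).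
Proof.
rewrite !tmonomialE -[RHS]big_split; apply: eq_bigr => i _.
rewrite (reindex (cast_ord (esym (val_shape_add u v i)))) /=; last first.
  by exists (cast_ord (val_shape_add u v i)) => j _; rewrite (cast_ordK, cast_ordKV).
rewrite big_split_ord /=; congr (_ * _); apply: eq_bigr => j _; congr (x i (_, _));
  rewrite !msubA; apply: eq_msub => k /=.
- exact: mu1_l.
- exact: mu2_l.
- exact: mu1_r.
- exact: mu2_r.
Qed.

Lemma basic_inv_R0_mul s t :
  basic_inv x s * basic_inv x t = basic_inv x (sym_mul s t) :> R.
Proof.
case: s => u s; case: t => v t; rewrite -!/(psym _) !basic_invE /=.
(* Writing the trace index as [ext a] absorbs the factor mu2^-1 of [sym_mul]; [glue] then splits the
   trace into a product of two traces. *)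
pose ext (a : multi d (deg u + deg v)) := msub a (mu2 u v \o @unadd u v).
have ext_bij : bijective ext.
  exists (fun a => msub a (cast_ord (deg_add u v) \o (mu2 u v)^-1%g)) => a.
    by rewrite /ext msubA msub_id // => j; rewrite /= /unadd cast_ordK permKV.
  by rewrite /ext msubA msub_id // => j; rewrite /= permK /unadd cast_ordKV.
rewrite [RHS](reindex ext) /=; last exact/onW_bij.
pose glue (ab : multi d (deg u) * multi d (deg v)) : multi d (deg u + deg v) :=
  [ffun j => match split j with inl i => ab.1 i | inr i => ab.2 i end].
have glueL ab : msub (glue ab) (lshift (deg v)) = ab.1.
  by apply/ffunP=> j; rewrite !ffunE (unsplitK (inl _)).
have glueR ab : msub (glue ab) (@rshift (deg u) (deg v)) = ab.2.
  by apply/ffunP=> j; rewrite !ffunE (unsplitK (inr _)).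
rewrite [RHS](reindex glue); last first.
  exists (fun a => (msub a (lshift (deg v)), msub a (@rshift (deg u) (deg v)))) => ab _.
    by rewrite glueL glueR; case: ab.
  by apply/ffunP=> j; rewrite ffunE -{2}[j]splitK; case: split => i; rewrite ffunE.
rewrite big_distrlr pair_bigA; apply: eq_bigr => -[a b] _ /=.
have -> : msub (ext (glue (a, b))) (cast_perm (deg_add u v)
    (Defs.pcomp (Defs.pcomp (mu2 u v)^-1%g (pair_perm s t)) (mu1 u v))) =
  msub (msub (glue (a, b)) (pair_perm s t)) (mu1 u v \o @unadd u v).
  rewrite /ext !msubA; apply: eq_msub => j.
  by rewrite /= cast_permE /unadd cast_ordK !permM permKV.
rewrite tmonomial_add glueL glueR; congr (tmonomial x u (_, _) * tmonomial x v (_, _)).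
  apply/ffunP=> j; rewrite msubA !ffunE /= permE /pair_fun (unsplitK (inl _)).
  by rewrite (unsplitK (inl _)).
apply/ffunP=> j; rewrite msubA !ffunE /= permE /pair_fun (unsplitK (inr _)).
by rewrite (unsplitK (inr _)).
Qed.

End Ring.
End Product.

(** * Commutants and Reynolds operators *)

(** [kappa] is a pseudo-inverse A^+ of the matrix A with rows L_s; A A^+ A = A says that v -> v
    kappa L fixes the span of the rows. *)
Lemma projection_kernel (F : fieldType) (S I : finType) (L : S -> I -> F) :
  exists kappa : I -> S -> F, forall t i,
    \sum_s (\sum_i' L t i' * kappa i' s) * L s i = L t i.
Proof.
pose A := \matrix_(a < #|S|, b < #|I|) L (enum_val a) (enum_val b).
exists (fun i s => pinvmx A (enum_rank i) (enum_rank s)) => t i.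
have /matrixP/(_ (enum_rank t) (enum_rank i)) := mulmxKpV (submx_refl A).
rewrite !mxE !enum_rankK => <-; rewrite (reindex_onto enum_val enum_rank) /=; last first.
  by move=> s _; rewrite enum_rankK.
apply: eq_big => [k|k _]; first by rewrite enum_valK eqxx.
rewrite !mxE !enum_rankK enum_valK; congr (_ * _).
rewrite (reindex_onto enum_val enum_rank) /=; last by move=> s _; rewrite enum_rankK.
apply: eq_big => [l|l _]; first by rewrite enum_valK eqxx.
by rewrite !mxE enum_rankK enum_valK.
Qed.

(** Adding a vector outside the span raises the dimension, which is bounded; excluded middle decides
    whether there is such a vector. *)
Lemma finite_span (F : fieldType) (V : vectType F) (G : Type) (v : G -> V) :
  exists s : seq G, forall g, v g \in <<map v s>>%VS.
Proof.
suff H k (s : seq G) : (\dim {:V} - \dim <<map v s>> < k)%N ->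
    exists s : seq G, forall g, v g \in <<map v s>>%VS.
  exact: (H _ [::] (ltnSn _)).
elim: k s => // k IH s; rewrite ltnS => le_k.
have [h|] := classic (forall g, v g \in <<map v s>>%VS); first by exists s.
move=> /not_all_ex_not[g /negP gs]; apply: (IH (g :: s)).
have lt_dim : (\dim <<map v s>> < \dim <<map v (g :: s)>>)%N.
  have sub : (<<map v s>> <= <<map v (g :: s)>>)%VS by rewrite /= span_cons addvSr.
  rewrite (ltn_leqif (dimv_leqif_sup sub)); apply: contra gs => /subvP; apply.
  by rewrite memv_span // mem_head.
apply: leq_trans le_k; apply: ltn_sub2l => //.
by apply: leq_trans lt_dim _; apply: dimvS (subvf _).
Qed.

Section OrthogonalReynolds.
Variables (F : realFieldType) (N : nat).
Import Num.Theory.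
Local Notation dot A B := (\tr (A *m B^T)).
Implicit Types A B : 'M[F]_N.

Lemma dot_eq0 A : dot A A = 0 -> A = 0.
Proof.
have dotE : dot A A = \sum_i \sum_j A i j ^+ 2.
  by rewrite /mxtrace; apply: eq_bigr => i _; rewrite mxE; apply: eq_bigr => j _; rewrite mxE expr2.
have ge0 i : 0 <= \sum_j A i j ^+ 2 by apply: sumr_ge0 => j _; apply: sqr_ge0.
move=> A0; apply/matrixP=> i j; rewrite mxE; apply/eqP; rewrite -sqrf_eq0; apply/eqP.
have /(_ i isT) : forall i, true -> \sum_j A i j ^+ 2 = 0.
  by apply: (psumr_eq0P (fun i _ => ge0 i)); rewrite -dotE.
by move/(psumr_eq0P (fun j _ => sqr_ge0 (A i j))); apply.
Qed.

Lemma dot_sumr A (I : Type) (r : seq I) (c : I -> F) (B : I -> 'M[F]_N) :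
  dot A (\sum_(i <- r) c i *: B i) = \sum_(i <- r) c i * dot A (B i).
Proof.
rewrite raddf_sum mulmx_sumr raddf_sum; apply: eq_bigr => i _.
by rewrite /= linearZ /= -scalemxAr linearZ.
Qed.

Lemma dotC A B : dot A B = dot B A.
Proof. by rewrite -mxtrace_tr trmx_mul trmxK. Qed.

(** The normal equations y Gram = u are solvable: by positivity a kernel vector of the Gram matrix
    is a linear relation between the [w i], and so annihilates u. *)
Lemma orthogonal_projection k (w : 'I_k -> 'M[F]_N) (v : 'M[F]_N) :
  exists y : 'I_k -> F, forall j, dot (v - \sum_i y i *: w i) (w j) = 0.
Proof.
pose Gram := \matrix_(i, j) dot (w i) (w j).
pose u : 'rV_k := \row_j dot v (w j).
have /submxP[y uE] : (u <= Gram)%MS.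
  apply/submxP; apply/submxP; rewrite submxE; apply/eqP/matrixP=> i0 j0; rewrite mxE [RHS]mxE.
  pose z i := cokermx Gram i j0.
  have Gz i : \sum_j dot (w i) (w j) * z j = 0.
    have /matrixP/(_ i j0) := mulmx_coker Gram; rewrite mxE [RHS]mxE => Gz; rewrite -[RHS]Gz.
    by apply: eq_bigr => j _; rewrite mxE.
  have wz0 : \sum_i z i *: w i = 0.
    apply: dot_eq0; rewrite dot_sumr big1 // => i _.
    rewrite dotC dot_sumr (eq_bigr (fun j => dot (w i) (w j) * z j)) ?Gz ?mulr0 //.
    by move=> j _; rewrite mulrC.
  have := dot_sumr v (index_enum 'I_k) z w.
  rewrite wz0 trmx0 mulmx0 mxtrace0 => v0; rewrite [RHS]v0; apply: eq_bigr => i _.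
  by rewrite mxE mulrC.
exists (y 0) => j; rewrite mulmxBl linearB /=.
have /matrixP/(_ 0 j) := uE; rewrite !mxE => ->; apply/eqP; rewrite subr_eq0; apply/eqP.
by rewrite [RHS]dotC dot_sumr; apply: eq_bigr => i _; rewrite mxE dotC.
Qed.

(* [e] is the orthogonal projection of the identity on the orthogonal of the
   span of the [rho g - 1]; closure under transposition makes it right
   invariant. *)
Lemma reynolds_matrix (G : Type) (rho : G -> 'M[F]_N) (g1 : G) :
  rho g1 = 1%:M ->
  (forall g h, exists k, rho k = rho g *m rho h) ->
  (forall g, exists h, rho h = (rho g)^T) ->
  exists2 s : seq (F * G), \sum_(x <- s) x.1 = 1 &
    forall g, (\sum_(x <- s) x.1 *: rho x.2) *m rho g = \sum_(x <- s) x.1 *: rho x.2.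
Proof.
move=> rho1 rhoM rhoT.
have [l lP] := finite_span (fun g => rho g - 1%:M).
pose w (i : 'I_(size l)) := rho (nth g1 l i) - 1%:M.
have [y yP] := orthogonal_projection w 1%:M.
set e := 1%:M - _ in yP.
have e_orth g : dot e (rho g - 1%:M) = 0.
  pose X := in_tuple [seq rho g - 1%:M | g <- l].
  have gX : rho g - 1%:M \in <<X>>%VS := lP g.
  rewrite (coord_span gX) dot_sumr big1 // => i _.
  have sz : (i < size l)%N by rewrite -(size_map (fun g => rho g - 1%:M)).
  by rewrite (nth_map g1) // (yP (Ordinal sz)) mulr0.
(* [e] written on group elements: the unit collects 1 + sum y_i, which makes the sum of all
   coefficients 1. *)
pose s := (1 + \sum_i y i, g1) :: [seq (- y i, nth g1 l i) | i <- index_enum 'I_(size l)].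
exists s; first by rewrite big_cons big_map /= sumrN addrK.
have eE : \sum_(x <- s) x.1 *: rho x.2 = e.
  rewrite big_cons big_map /= rho1 scalerDl scale1r -addrA; congr (_ + _).
  rewrite scaler_suml -big_split -sumrN; apply: eq_bigr => i _ /=.
  by rewrite scalerBr opprB scaleNr addrC.
(* The product of e with every [rho h] is the same, so the difference f of the two sides is
   orthogonal to all of them; being a combination of such matrices, f is orthogonal to itself. *)
rewrite eE; have eT g : e *m (rho g)^T = e.
  apply/eqP; rewrite -subr_eq0; apply/eqP/dot_eq0; set f := _ - e.
  have f_orth h : dot f (rho h) = 0.
    have [k kE] := rhoM h g.
    have -> : dot f (rho h) = dot e (rho k - 1%:M) - dot e (rho h - 1%:M).
      rewrite -linearB -mulmxBr -linearB /= opprB addrA subrK kE.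
      by rewrite linearB /= trmx_mul mulmxBr mulmxA -mulmxBl.
    by rewrite !e_orth subr0.
  have f_sum (r : seq (F * G)) : dot f (\sum_(x <- r) x.1 *: rho x.2) = 0.
    by rewrite dot_sumr big1 // => x _; rewrite f_orth mulr0.
  have [h hE] := rhoT g; rewrite {2}/f linearB mulmxBr linearB /= -hE.
  rewrite -eE f_sum subr0 mulmx_suml.
  under eq_bigr => x _ do rewrite -scalemxAl.
  rewrite dot_sumr big1 // => x _; have [k <-] := rhoM x.2 h.
  by rewrite f_orth mulr0.
by move=> g; have [h hE] := rhoT g; rewrite -[rho g]trmxK -hE eT.
Qed.

End OrthogonalReynolds.

Section DoubleCommutant.
Variables (F : fieldType) (d n : nat).
Hypothesis n_unit : n`!%:R != 0 :> F.
Local Notation I := (multi d n).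

Definition permutation_invariant (X : I -> I -> F) :=
  forall (s : 'S_n) b a, X (msub b s) (msub a s) = X b a.

(* Averaging over S_n a projection of End(W^{(x)n}) on the span of the L_s gives
   a projection [P] that is linear over the left multiplications by the L_s,
   hence has its kernel [Q] in the commutant of S_n.  So [T] commutes with it,
   and [T = T P(1) = P(T)]. *)
Lemma double_commutant (T : I -> I -> F) :
  (forall X, permutation_invariant X ->
     forall b a, \sum_e T b e * X e a = \sum_e X b e * T e a) ->
  exists z : 'S_n -> F, forall b a, T b a = \sum_(s : 'S_n) z s * (msub b s == a)%:R.
Proof.
move=> commT.
have [kappa kP] := projection_kernel (fun (s : 'S_n) (ba : I * I) => (msub ba.1 s == ba.2)%:R : F).
(* The entry (b, a) of the image of the matrix unit E_{c,a'} under the averaged projection; the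
   arguments are ordered so that [Q a a'] is a matrix commuting with S_n. *)
pose Q (a a' b c : I) := n`!%:R^-1 * \sum_(s : 'S_n) \sum_(t : 'S_n)
  kappa (msub c s^-1%g, a') t * (msub (msub b s^-1%g) t == a)%:R.
have Q_inv a a' : permutation_invariant (Q a a').
  move=> w b c; congr (_ * _).
  rewrite (reindex_inj (mulgI w)); apply: eq_bigr => s _; apply: eq_bigr => t _.
  have wE b' : msub (msub b' w) (w * s)^-1%g = msub b' s^-1%g.
    by rewrite msubA; apply: eq_msub => j; rewrite /= invMg permM permKV.
  by rewrite !wE.
have Q1 a c : \sum_a' Q a a' c a' = (c == a)%:R.
  rewrite -big_distrr exchange_big /=.
  rewrite (eq_bigr (fun=> (c == a)%:R)) => [|s _].
    rewrite sumr_const card_Sn -[X in _ * X]mulr_natl mulrA mulVf ?mul1r //.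
  have <- : (msub (msub c s^-1%g) s == a)%:R = (c == a)%:R :> F.
    by rewrite msubA msub_id // => j; rewrite /= permK.
  rewrite -[RHS](kP s (msub c s^-1%g, a)) exchange_big; apply: eq_bigr => t _ /=.
  rewrite -big_distrl; congr (_ * _).
  rewrite [RHS](eq_bigr (fun p => (msub p.1 s == p.2)%:R * kappa (p.1, p.2) t)); last by case.
  rewrite -(pair_bigA _ (fun b' a' => (msub b' s == a')%:R * kappa (b', a') t)) /=.
  rewrite (reindex_msub s (fun a' => kappa (msub a' s^-1%g, a') t)).
  apply: eq_bigr => b' _; rewrite (bigD1 (msub b' s)) //= eqxx mul1r big1 ?addr0.
    by rewrite msubA msub_id // => j; rewrite /= permKV.
  by move=> a'; rewrite eq_sym => /negPf->; rewrite mul0r.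
have TE b a : T b a = \sum_a' \sum_c Q a a' b c * T c a'.
  under eq_bigr => a' _ do rewrite -commT //.
  rewrite exchange_big; under eq_bigr => c _ do rewrite -big_distrr /= Q1.
  rewrite (bigD1 a) //= eqxx mulr1 big1 ?addr0 // => c /negPf->.
  by rewrite mulr0.
pose y (s t : 'S_n) := n`!%:R^-1 * \sum_a' \sum_c kappa (msub c s^-1%g, a') t * T c a'.
exists (fun w => \sum_(s : 'S_n) y s (w * s)%g) => b a.
under [RHS]eq_bigr => w _ do rewrite big_distrl /=.
rewrite exchange_big TE /=.
transitivity (\sum_(s : 'S_n) \sum_(t : 'S_n) y s t * (msub (msub b s^-1%g) t == a)%:R).
  under [RHS]eq_bigr => s _ do under eq_bigr => t _ do
    rewrite /y -mulrA big_distrl big_distrr /=.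
  under [RHS]eq_bigr => s _ do rewrite exchange_big /=.
  rewrite [RHS]exchange_big; apply: eq_bigr => a' _.
  under [RHS]eq_bigr => s _ do under eq_bigr => t _ do
    rewrite big_distrl big_distrr /=.
  under [RHS]eq_bigr => s _ do rewrite exchange_big /=.
  rewrite [RHS]exchange_big; apply: eq_bigr => c _ /=.
  rewrite /Q -mulrA big_distrl big_distrr; apply: eq_bigr => s _ /=.
  rewrite big_distrl big_distrr; apply: eq_bigr => t _ /=.
  by rewrite mulrAC.
apply: eq_bigr => s _; rewrite (reindex_inj (mulIg s)); apply: eq_bigr => w _.
congr (_ * (_ == a)%:R); rewrite msubA; apply: eq_msub => j.
by rewrite /= permM permK.
Qed.

End DoubleCommutant.

(** * Polynomials vanishing at all points *)

Lemma base_expansion_inj N n (m1 m2 : 'I_n -> nat) :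
  (forall i, m1 i < N)%N -> (forall i, m2 i < N)%N ->
  (\sum_(i < n) m1 i * N ^ i = \sum_(i < n) m2 i * N ^ i)%N -> m1 =1 m2.
Proof.
elim: n m1 m2 => [|n IH] m1 m2 lt1 lt2; first by move=> _ [].
rewrite !big_ord_recl !expn0 !muln1 => e.
have sumE (m : 'I_n.+1 -> nat) :
    (\sum_(i < n) m (lift ord0 i) * N ^ lift ord0 i = N * \sum_(i < n) m (lift ord0 i) * N ^ i)%N.
  by rewrite big_distrr; apply: eq_bigr => i _; rewrite lift0 expnS mulnCA.
rewrite !sumE in e.
have N0 : (0 < N)%N by apply: leq_ltn_trans (lt1 ord0).
have e0 : m1 ord0 = m2 ord0.
  by have := congr1 (modn^~ N) e;
    rewrite ![(m1 _ + _)%N]addnC ![(m2 _ + _)%N]addnC !(mulnC N) !modnMDl !modn_small.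
move/eqP: e; rewrite e0 eqn_add2l eqn_pmul2l // => /eqP/IH eqS i.
have [j ->|-> //] := unliftP ord0 i.
by apply: (eqS (fun i => lt1 _) (fun i => lt2 _)).
Qed.

(** Only nonzero t correspond to invertible scalar matrices; the extra factor ['X] supplies the root
    0. *)
Lemma poly_eq0 (F : idomainType) (h : {poly F}) :
  (forall k, exists s : seq F, uniq s /\ size s = k) ->
  (forall t, t != 0 -> h.[t] = 0) -> h = 0.
Proof.
have X0 : 'X != 0 :> {poly F} by rewrite polyX_eq0.
move=> infF h0; apply/eqP; rewrite -(inj_eq (mulIf X0)) mul0r.
apply: contraT => hX; have [s [us sz]] := infF (size (h * 'X)).
have := max_poly_roots hX _ us; rewrite sz ltnn; apply; apply/allP=> t _.
apply/rootP; rewrite hornerM hornerX; have [->|/h0->] := eqVneq t 0.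
  by rewrite mulr0.
by rewrite mul0r.
Qed.

(* Kronecker substitution. *)
Lemma meval_eq0 (F : idomainType) n (f : mpoly n F) :
  (forall k, exists s : seq F, uniq s /\ size s = k) ->
  (forall v, f.@[v] = 0) -> f = 0.
Proof.
move=> infF f0; apply/mpolyP=> m; rewrite mcoeff0.
(* Larger than every exponent, so that base N digits recover the monomial from its image. *)
pose N := (\max_(m <- msupp f) mdeg m).+1.
have ltN m' i : m' \in msupp f -> (m' i < N)%N.
  move=> m'f; rewrite ltnS; apply: leq_trans (leq_bigmax_seq _ m'f isT).
  by rewrite mdegE (bigD1 i) //= leq_addr.
pose kr (m : 'X_{1..n}) := (\sum_(i < n) m i * N ^ i)%N.
pose g : {poly F} := \sum_(m' <- msupp f) f@_m' *: 'X^(kr m').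
have g0 : g = 0.
  apply: poly_eq0 infF _ => t _.
  rewrite -[RHS](f0 (fun i => t ^+ (N ^ i))) mevalE horner_sum; apply: eq_bigr => m' _.
  rewrite hornerZ hornerXn /kr expr_sum; congr (_ * _).
  by apply: eq_bigr => i _; rewrite -exprM mulnC.
have [mf|] := boolP (m \in msupp f); last by rewrite mcoeff_msupp => /negPn/eqP.
have := congr1 (fun g : {poly F} => g`_(kr m)) g0; rewrite coef0 coef_sum.
rewrite (bigD1_seq m) ?msupp_uniq //= coefZ coefXn eqxx mulr1 big1_seq ?addr0 //.
move=> m' /andP[m'm m'f]; rewrite coefZ coefXn; case: eqP => [e|]; last by rewrite mulr0.
case/eqP: m'm; apply/mnmP => i; symmetry.
by apply: (base_expansion_inj _ _ e) => j; apply: ltN.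
Qed.

Lemma char0_infinite (F : idomainType) : [pchar F] =i pred0 ->
  forall k, exists s : seq F, uniq s /\ size s = k.
Proof.
move=> charF k; exists [seq i%:R | i <- iota 0 k]; rewrite size_map size_iota; split=> //.
rewrite map_inj_uniq ?iota_uniq // => i j e.
wlog ij : i j e / (i <= j)%N => [H|].
  by case: (leqP i j) => [|/ltnW] ij; [exact: H | symmetry; exact: H].
move/eqP: e; rewrite eq_sym -subr_eq0 -natrB //.
by rewrite ((pcharf0P F).1 charF) subn_eq0 => ji; apply/eqP; rewrite eqn_leq ij.
Qed.

(** The sums count how often each index is taken, so f and g list the same multiset. *)
Lemma eq_sum_U_perm N n (f g : 'I_n -> 'I_N) :
  (\sum_j U_(f j) = \sum_j U_(g j))%MM -> exists s : 'S_n, forall j, g j = f (s j).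
Proof.
move=> e.
have cnt (h : 'I_n -> 'I_N) x : count_mem x [tuple h j | j < n] = (\sum_j U_(h j))%MM x.
  rewrite -sum1_count big_tuple big_mkcond mnm_sumE; apply: eq_bigr => j _.
  by rewrite tnth_mktuple mnm1E /=; case: eqP.
have : perm_eq [tuple g j | j < n] [tuple f j | j < n].
  by apply/allP=> x _ /=; rewrite !cnt e.
move/tuple_permP=> [s sE]; exists s => j.
have := congr1 (fun t => tnth t j) (val_inj sE).
by rewrite !tnth_mktuple.
Qed.

Section GLCommutant.
Variables (F : numFieldType) (d n : nat).
Import Num.Theory.
Local Notation I := (multi d n).

Let ix (i j : 'I_d) : 'I_#|{: 'I_d * 'I_d}| := enum_rank (i, j).

(** The monomial in the entries of g that equals the entry (b, a) of g^{(x)n}. *)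
Let mon (b a : I) := (\sum_j U_(ix (b j) (a j)))%MM.

Lemma mon_invariant X (b a b' a' : I) : permutation_invariant X ->
  mon b a = mon b' a' -> X b a = X b' a' :> F.
Proof.
move=> invX /eq_sum_U_perm[s sE]; rewrite -(invX s).
have {}sE j : (b' j, a' j) = (b (s j), a (s j)) by apply: enum_rank_inj; apply: sE.
by congr X; apply/ffunP=> j; rewrite ffunE; case: (sE j).
Qed.

(* The entries of [T g^{(x)n} = g^{(x)n} T] are polynomial identities in [g]; the
   entries of [X] depend only on the monomial, so [T X = X T] is a combination of
   the identities between coefficients. *)
Lemma commute_tpow_invariant (T : I -> I -> F) :
  (forall g : 'M[F]_d, g \in unitmx -> forall b a,
     \sum_e T b e * tpow g n (e, a) = \sum_e tpow g n (b, e) * T e a) ->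
  forall X, permutation_invariant X ->
     forall b a, \sum_e T b e * X e a = \sum_e X b e * T e a.
Proof.
move=> commT X invX b a.
pose k := #|{: 'I_d * 'I_d}|.
pose f : mpoly k F := \sum_e T b e *: 'X_[mon e a] - \sum_e T e a *: 'X_[mon b e].
pose gm : 'M_d := \matrix_(i, j) ('X_(ix i j) : mpoly k F).
pose mx (v : 'I_k -> F) : 'M[F]_d := \matrix_(i, j) v (ix i j).
have evX v b' a' : ('X_[mon b' a'] : mpoly k F).@[v] = tpow (mx v) n (b', a').
  rewrite ffunE /mon -mprodXE rmorph_prod; apply: eq_bigr => j _ /=.
  by rewrite mevalXU mxE.
have f0 : f = 0.
  have inf := char0_infinite (pchar_num F).
  (* The hypothesis covers invertible matrices only; the determinant takes care of the singular
     ones. *)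
  have : f * \det gm = 0.
    apply: (meval_eq0 inf) => v; rewrite mevalM.
    have -> : (\det gm).@[v] = \det (mx v).
      rewrite -(det_map_mx (meval v)); congr (\det _); apply/matrixP=> i j.
      by rewrite !mxE /= mevalXU.
    have [gu|] := boolP (mx v \in unitmx); last first.
      by rewrite unitmxE unitfE negbK => /eqP->; rewrite mulr0.
    rewrite (_ : f.@[v] = 0) ?mul0r // mevalB !rmorph_sum /=; apply/eqP; rewrite subr_eq0;
      apply/eqP.
    transitivity (\sum_e T b e * tpow (mx v) n (e, a)).
      by apply: eq_bigr => e _; rewrite mevalZ evX.
    by rewrite commT //; apply: eq_bigr => e _; rewrite mevalZ evX mulrC.
  move/eqP; rewrite mulf_eq0 => /orP[/eqP//|/eqP det0].
  have /eqP := congr1 (meval (fun c => ((enum_val c).1 == (enum_val c).2)%:R)) det0.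
  rewrite -(det_map_mx (meval _)) meval0 (_ : map_mx _ _ = 1%:M) ?det1 ?oner_eq0 //.
  by apply/matrixP=> i j; rewrite !mxE /= mevalXU enum_rankK.
(* Dividing by the size of the fibre of [mon] writes X as a combination of indicators of equal
   monomials, without choosing representatives. *)
pose w (ef : I * I) : F :=
  X ef.1 ef.2 / #|[pred ef' : I * I | mon ef'.1 ef'.2 == mon ef.1 ef.2]|%:R.
have wE e e' : \sum_(ef : I * I) w ef * (mon e e' == mon ef.1 ef.2)%:R = X e e'.
  rewrite (eq_bigr (fun ef : I * I => if mon ef.1 ef.2 == mon e e' then
      X e e' / #|[pred ef' : I * I | mon ef'.1 ef'.2 == mon e e']|%:R else 0)); last first.
    move=> ef _; rewrite eq_sym; case: eqP => [e_ef|]; last by rewrite mulr0.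
    by rewrite mulr1 /w (mon_invariant invX e_ef) e_ef.
  rewrite -big_mkcond sumr_const -[LHS]mulr_natr mulfVK // pnatr_eq0 -lt0n.
  by apply/card_gt0P; exists (e, e'); rewrite inE.
have cf m : f@_m = \sum_e T b e * (mon e a == m)%:R - \sum_e T e a * (mon b e == m)%:R.
  rewrite mcoeffB; congr (_ - _); rewrite raddf_sum; apply: eq_bigr => e _;
    by rewrite /= mcoeffZ mcoeffX.
have sumE (c : I -> F) (e e' : I -> I) : \sum_i c i * X (e i) (e' i) =
    \sum_(ef : I * I) w ef * \sum_i c i * (mon (e i) (e' i) == mon ef.1 ef.2)%:R.
  under [RHS]eq_bigr do rewrite big_distrr /=.
  rewrite exchange_big; apply: eq_bigr => i _; rewrite -wE big_distrr.
  by apply: eq_bigr => ef _; rewrite /= mulrCA.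
under [RHS]eq_bigr do rewrite mulrC.
rewrite (sumE (T b) id (fun=> a)) (sumE (T^~ a) (fun=> b) id); apply: eq_bigr => ef _.
by congr (_ * _); apply/eqP; rewrite -subr_eq0 -cf f0 mcoeff0.
Qed.

Lemma gl_commutant_span (T : I -> I -> F) :
  (forall g : 'M[F]_d, g \in unitmx -> forall b a,
     \sum_e T b e * tpow g n (e, a) = \sum_e tpow g n (b, e) * T e a) ->
  exists z : 'S_n -> F, forall b a, T b a = \sum_(s : 'S_n) z s * (msub b s == a)%:R.
Proof.
move=> commT; apply: double_commutant; last exact: commute_tpow_invariant.
by rewrite pnatr_eq0 -lt0n fact_gt0.
Qed.

End GLCommutant.

(** * The rational numbers in a field of characteristic zero *)

Section RationalNumbers.
Variable K : fieldType.
Hypothesis charK : [pchar K] =i pred0.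

Lemma char0_intr_eq0 (a : int) : (a%:~R == 0 :> K) = (a == 0).
Proof.
by case: a => n; rewrite ?NegzE ?mulrNz ?oppr_eq0 -pmulrn ((pcharf0P K).1 charK).
Qed.

(** [ratr] is computed from the reduced fraction; allowing any fraction for x reduces the morphism
    laws to clearing denominators. *)
Lemma ratr_char0P x (a b : int) :
  b != 0 -> x * b%:~R = a%:~R -> @ratr K x = a%:~R / b%:~R.
Proof.
move=> b0 xb; apply/eqP; rewrite eqr_div ?char0_intr_eq0 ?denq_eq0 //.
rewrite -!rmorphM; apply/eqP; congr _%:~R; apply: (@intr_inj rat).
by rewrite !rmorphM /= -xb numqE mulrAC.
Qed.

Fact ratr_char0_zmod_morphism : zmod_morphism (@ratr K).
Proof.
move=> x y; have nz z : (denq z)%:~R != 0 :> K by rewrite char0_intr_eq0 denq_eq0.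
rewrite (@ratr_char0P _ (numq x * denq y - numq y * denq x) (denq x * denq y)).
- by rewrite !rmorphB !rmorphM /= /ratr; field; rewrite !nz.
- by rewrite mulf_neq0 // denq_eq0.
- by rewrite !rmorphB !rmorphM /= !numqE; ring.
Qed.

Fact ratr_char0_monoid_morphism : monoid_morphism (@ratr K).
Proof.
split=> [|x y]; first by rewrite /ratr divr1.
have nz z : (denq z)%:~R != 0 :> K by rewrite char0_intr_eq0 denq_eq0.
rewrite (@ratr_char0P _ (numq x * numq y) (denq x * denq y)).
- by rewrite !rmorphM /= /ratr; field; rewrite !nz.
- by rewrite mulf_neq0 // denq_eq0.
- by rewrite !rmorphM /= !numqE; ring.
Qed.

Lemma rat_embedding : exists phi : {rmorphism rat -> K}, phi =1 @ratr K.
Proof.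
pose fA := GRing.isZmodMorphism.Build rat K (@ratr K) ratr_char0_zmod_morphism.
pose fM := GRing.isMonoidMorphism.Build rat K (@ratr K) ratr_char0_monoid_morphism.
pose phi : {rmorphism rat -> K} := HB.pack (@ratr K) fA fM.
by exists phi.
Qed.

End RationalNumbers.

Lemma invmx_mulmx (R : comUnitRingType) d (g h : 'M[R]_d) :
  g \in unitmx -> h \in unitmx -> invmx (g *m h) = invmx h *m invmx g.
Proof.
move=> gu hu; have ghu : g *m h \in unitmx by rewrite unitmx_mul gu.
by rewrite -[RHS]mul1mx -(mulVmx ghu) -mulmxA (mulmxA _ (invmx h)) mulmxK // mulmxV // mulmx1.
Qed.

Section ReynoldsOperators.
Variable d : nat.

(* The matrix entries of the conjugation by [g] on End(W^{(x)n}); [(b, a)] is the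
   row, so that they give the coefficients of [(g . x)(b, a)]. *)
Definition conj_entry (R : comUnitRingType) (g : 'M[R]_d) n (b a b' a' : multi d n) : R :=
  tpow g n (b, b') * tpow (invmx g) n (a', a).

Lemma conj_entry_mul (R : comUnitRingType) (g h : 'M[R]_d) n (b a b' a' : multi d n) :
  g \in unitmx -> h \in unitmx ->
  conj_entry (g *m h) b a b' a' =
  \sum_b'' \sum_a'' conj_entry g b a b'' a'' * conj_entry h b'' a'' b' a'.
Proof.
move=> gu hu; rewrite /conj_entry invmx_mulmx // -!tpow_mul big_distrl; apply: eq_bigr => b'' _.
by rewrite big_distrr; apply: eq_bigr => a'' _ /=; ring.
Qed.

(** This is Tr(L_s g M g^-1) = Tr(L_s M) for M the matrix unit at (b', a'): g^{(x)n} commutes with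
    L_s. *)
Lemma conj_entry_Lperm (R : comUnitRingType) (g : 'M[R]_d) n (s : 'S_n) b' a' :
  g \in unitmx ->
  \sum_a conj_entry g (msub a s) a b' a' = (msub a' s == b')%:R.
Proof.
move=> gu; under eq_bigr => a _ do
  rewrite /conj_entry mulrC -(tpow_msub (invmx g) s a' a).
rewrite -(reindex_msub s (fun a => tpow _ _ (_, a) * tpow _ _ (a, _))) tpow_mul mulVmx //.
exact: tpow1.
Qed.

Definition group_algebra_unit (R : comUnitRingType) (s : seq (R * 'M[R]_d)) :=
  all (fun x => x.2 \in unitmx) s && (\sum_(x <- s) x.1 == 1).

(* [s] is an element of the group algebra of GL_d, of augmentation 1, which
   maps End(W^{(x)n}) to the span of the L_z. *)
Definition reynolds_for (R : comUnitRingType) (s : seq (R * 'M[R]_d)) n :=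
  forall b a : multi d n, exists z : 'S_n -> R, forall b' a',
    \sum_(x <- s) x.1 * conj_entry x.2 b a b' a' =
    \sum_(t : 'S_n) z t * (msub a' t == b')%:R.

(** [reynolds_matrix] is applied to conjugation on End(W^{(x)n}), where transposing g transposes the
    matrix of the action. *)
Lemma reynolds_real (F : realFieldType) n :
  exists2 s : seq (F * 'M[F]_d), group_algebra_unit s & reynolds_for s n.
Proof.
pose G := {g : 'M[F]_d | g \in unitmx}; pose mkG g gu : G := exist (fun g => g \in unitmx) g gu.
pose I := (multi d n * multi d n)%type.
pose rho (g : G) : 'M[F]_#|{: I}| := \matrix_(i, j)
  conj_entry (val g) (enum_val i).1 (enum_val i).2 (enum_val j).1 (enum_val j).2.
have sum_I (f : I -> F) : \sum_(i < #|{: I}|) f (enum_val i) = \sum_b \sum_a f (b, a).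
  rewrite (pair_bigA _ (fun b a => f (b, a))) /= [RHS](reindex_onto enum_val enum_rank) /=.
    by apply: eq_big => [i|i _]; rewrite ?enum_valK ?eqxx //; case: enum_val.
  by move=> i _; rewrite enum_rankK.
have rhoM g h : exists k, rho k = rho g *m rho h.
  have ghu : val g *m val h \in unitmx by rewrite unitmx_mul (valP g) (valP h).
  exists (mkG _ ghu); apply/matrixP=> i j; rewrite !mxE conj_entry_mul ?(valP g) ?(valP h) //.
  rewrite -(sum_I (fun c => conj_entry (val g) _ _ c.1 c.2 * conj_entry (val h) c.1 c.2 _ _)).
  by apply: eq_bigr => k _; rewrite !mxE.
have rhoT g : exists h, rho h = (rho g)^T.
  have gTu : (val g)^T \in unitmx by rewrite unitmx_tr (valP g).
  exists (mkG _ gTu); apply/matrixP=> i j; rewrite !mxE /conj_entry -trmx_inv.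
  by congr (_ * _); rewrite !ffunE; apply: eq_bigr => k _; rewrite mxE.
have rho1 : rho (mkG 1%:M (unitmx1 F d)) = 1%:M.
  apply/matrixP=> i j; rewrite !mxE /conj_entry /= invmx1 !tpow1 -natrM mulnb.
  rewrite -(inj_eq enum_val_inj) -pair_eqE /= /pair_eq [_.2 == _.2]eq_sym.
  by [].
have [s s1 sP] := reynolds_matrix rho1 rhoM rhoT.
exists [seq (x.1, val x.2) | x <- s].
  apply/andP; split; last by rewrite big_map s1.
  by apply/allP=> _ /mapP[x _ ->]; apply: valP.
move=> b a; pose E := \sum_(x <- s) x.1 *: rho x.2.
(* A row of E read as a matrix with its two indices exchanged: right invariance of E says that it
   commutes with g^{(x)n}. *)
pose T a' b' := E (enum_rank (b, a)) (enum_rank (b', a')).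
have TE b' a' : \sum_(x <- [seq (x.1, val x.2) | x <- s]) x.1 * conj_entry x.2 b a b' a' = T a' b'.
  rewrite big_map /T /E summxE; apply: eq_bigr => x _.
  by rewrite !mxE !enum_rankK.
have [z zP] : exists z : 'S_n -> F, forall a' b', T a' b' = \sum_(t : 'S_n) z t * (msub a' t ==
  b')%:R.
  apply: gl_commutant_span => g gu a' c.
  have invT b1 a1 : T a1 b1 = \sum_b2 \sum_a2 T a2 b2 * conj_entry g b2 a2 b1 a1.
    have /matrixP/(_ (enum_rank (b, a)) (enum_rank (b1, a1))) := sP (mkG g gu).
    rewrite -/E mxE {1}/T => <-.
    rewrite -(sum_I (fun c => T c.2 c.1 * conj_entry g c.1 c.2 b1 a1)).
    apply: eq_bigr => i _; rewrite /T -surjective_pairing enum_valK.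
    by rewrite [rho _ _ _]mxE enum_rankK.
  under [RHS]eq_bigr => e _ do rewrite invT big_distrr /=.
  rewrite exchange_big; apply: eq_bigr => b2 _ /=.
  under [RHS]eq_bigr => e _ do rewrite big_distrr /=.
  rewrite exchange_big /=; transitivity (\sum_a2 T a2 b2 * tpow g n (b2, c) * (a' == a2)%:R).
    by rewrite (bigD1 a') //= eqxx mulr1 big1 ?addr0 // => a2; rewrite eq_sym => /negPf->;
      rewrite mulr0.
  apply: eq_bigr => a2 _; rewrite -tpow1 -(mulmxV gu) -tpow_mul big_distrr.
  by apply: eq_bigr => e _; rewrite /conj_entry /=; ring.
by exists z => b' a'; rewrite TE zP.
Qed.

Section Transport.
Variable K : fieldType.
Hypothesis charK : [pchar K] =i pred0.

(** The orthogonal projection uses an ordered field; it is taken over the rationals and its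
    coefficients and matrices are mapped to K. *)
Lemma reynolds_char0 n :
  exists2 s : seq (K * 'M[K]_d), group_algebra_unit s & reynolds_for s n.
Proof.
have [s /andP[su s1] sP] := reynolds_real rat n.
have [phi _] := rat_embedding charK.
have tpow_map (g : 'M[rat]_d) b a : tpow (map_mx phi g) n (b, a) = phi (tpow g n (b, a)).
  by rewrite !ffunE rmorph_prod; apply: eq_bigr => j _; rewrite mxE.
exists [seq (phi x.1, map_mx phi x.2) | x <- s].
  apply/andP; split; last by rewrite big_map /= -(rmorph_sum phi) (eqP s1) rmorph1.
  by apply/allP=> _ /mapP[x /(allP su) xu ->]; rewrite map_unitmx.
move=> b a; have [z zP] := sP b a; exists (phi \o z) => b' a'.
rewrite big_map; transitivity (phi (\sum_(x <- s) x.1 * conj_entry x.2 b a b' a')).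
  rewrite rmorph_sum; apply: eq_bigr => x _.
  by rewrite /conj_entry -map_invmx !tpow_map !rmorphM.
by rewrite zP rmorph_sum; apply: eq_bigr => t _; rewrite rmorphM rmorph_nat.
Qed.

(* The product of group algebra elements that are good for [n] and for all
   smaller degrees is good for both, since augmentation 1 fixes the L_z. *)
Lemma reynolds_lt N :
  exists2 s : seq (K * 'M[K]_d), group_algebra_unit s &
    forall n, (n < N)%N -> reynolds_for s n.
Proof.
elim: N => [|N [s2 /andP[s2u s21] s2P]].
  exists [:: (1, 1%:M)] => //; 
  by rewrite /group_algebra_unit /= unitmx1 big_seq1 eqxx.
have [s1 /andP[s1u s11] s1P] := reynolds_char0 N.
pose s := [seq (x.1 * y.1, x.2 *m y.2) | x <- s1, y <- s2].
have sE n (b a b' a' : multi d n) : \sum_(x <- s) x.1 * conj_entry x.2 b a b' a' =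
    \sum_b'' \sum_a'' (\sum_(x <- s1) x.1 * conj_entry x.2 b a b'' a'') *
      (\sum_(y <- s2) y.1 * conj_entry y.2 b'' a'' b' a').
  rewrite big_allpairs_dep.
  transitivity (\sum_(x <- s1) \sum_(y <- s2) \sum_b'' \sum_a''
    (x.1 * conj_entry x.2 b a b'' a'') * (y.1 * conj_entry y.2 b'' a'' b' a')).
    rewrite big_seq [RHS]big_seq; apply: eq_bigr => x /(allP s1u) xu.
    rewrite big_seq [RHS]big_seq; apply: eq_bigr => y /(allP s2u) yu.
    rewrite conj_entry_mul // big_distrr; apply: eq_bigr => b'' _.
    by rewrite big_distrr; apply: eq_bigr => a'' _ /=; ring.
  under eq_bigr => x _ do rewrite exchange_big.
  rewrite exchange_big; apply: eq_bigr => b'' _ /=.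
  under eq_bigr => x _ do rewrite exchange_big.
  rewrite exchange_big; apply: eq_bigr => a'' _ /=.
  by rewrite big_distrlr.
exists s.
  apply/andP; split.
    apply/allP=> _ /allpairsP[[x y] /= [/(allP s1u) xu /(allP s2u) yu ->]].
    by rewrite /= unitmx_mul xu.
  by rewrite big_allpairs_dep /= -big_distrlr /= (eqP s11) (eqP s21) mulr1.
(* For n < N the factor s2 already produces combinations of the L_t. For n = N the factor s1 does,
   and s2 fixes each L_t. *)
move=> n; rewrite ltnS leq_eqVlt => /orP[/eqP nN|/s2P s2n] b a; last first.
  have /fin_all_exists[z zP] (ba : multi d n * multi d n) := s2n ba.1 ba.2.
  exists (fun t => \sum_b'' \sum_a'' (\sum_(x <- s1) x.1 * conj_entry x.2 b a b'' a'') * z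
    (b'', a'') t).
  move=> b' a'; rewrite sE; under [RHS]eq_bigr => t _ do rewrite big_distrl /=.
  rewrite [RHS]exchange_big; apply: eq_bigr => b'' _ /=.
  under [RHS]eq_bigr => t _ do rewrite big_distrl /=.
  rewrite [RHS]exchange_big; apply: eq_bigr => a'' _ /=.
  rewrite (zP (b'', a'')) big_distrr; apply: eq_bigr => t _ /=; exact: mulrA.
subst n; have [z zP] := s1P b a; exists z => b' a'; rewrite sE.
under eq_bigr => b'' _ do under eq_bigr => a'' _ do rewrite zP.
rewrite exchange_big /=.
transitivity (\sum_a'' \sum_(t : 'S_N) z t * \sum_(y <- s2) y.1 * conj_entry y.2 (msub a'' t)
  a'' b' a').
  apply: eq_bigr => a'' _; under eq_bigr => b'' _ do rewrite big_distrl /=.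
  rewrite exchange_big; apply: eq_bigr => t _ /=.
  rewrite (bigD1 (msub a'' t)) //= eqxx mulr1 [X in _ + X]big1 ?addr0 // => b''.
  by rewrite eq_sym => /negPf->; rewrite mulr0 mul0r.
rewrite exchange_big; apply: eq_bigr => t _ /=; rewrite -big_distrr; congr (_ * _).
rewrite exchange_big /=.
transitivity (\sum_(y <- s2) y.1 * (msub a' t == b')%:R); last first.
  by rewrite -big_distrl /= (eqP s21) mul1r.
rewrite big_seq [RHS]big_seq; apply: eq_bigr => y /(allP s2u) yu.
by rewrite -big_distrr conj_entry_Lperm.
Qed.

End Transport.
End ReynoldsOperators.

(** * Monomials of the generic structure *)

Section Monomials.
Variables (K : fieldType) (r : nat) (p q : 'I_r -> nat) (d : nat).
Implicit Types u : Defs.shape p q.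
Local Notation N := #|{: Defs.coord p q d}|.
Local Notation KU := (KU p q K d).

Definition cidx i (ba : entry p q d i) : 'I_N := enum_rank (Tagged (entry p q d) ba).

Lemma cidx_inj i : injective (@cidx i).
Proof. by move=> ba ba' /enum_rank_inj/eqP; rewrite eq_Tagged => /eqP. Qed.

Definition ctype (c : 'I_N) : 'I_r := tag (enum_val c).

Lemma ctype_cidx i ba : ctype (@cidx i ba) = i.
Proof. by rewrite /ctype enum_rankK. Qed.

Lemma cidx_surj c : exists ba : entry p q d (ctype c), c = cidx ba.
Proof.
exists (tagged (enum_val c)); rewrite /cidx -[LHS]enum_valK; congr enum_rank.
by rewrite /ctype; case: enum_val.
Qed.

(* The exponents of the coordinates in the entry [(b, a)] of the generic
   x_1^{(x)n_1} (x) .. (x) x_r^{(x)n_r}. *)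
Definition tm u (b a : multi d (deg u)) : 'X_{1..N} :=
  (\sum_i \sum_(j < val u i) U_(@cidx i (msub b (posP j), msub a (posQ j))))%MM.

Lemma tmonomial_generic u b a :
  tmonomial (generic_point p q K d) u (b, a) = 'X_[tm b a].
Proof.
rewrite tmonomialE -mprodXE; apply: eq_bigr => i _.
by rewrite -mprodXE; apply: eq_bigr => j _; rewrite !ffunE.
Qed.

Lemma inv_polyE u s : inv_poly K d (psym s) = \sum_a 'X_[@tm u (msub a s) a].
Proof. by rewrite /inv_poly basic_invE; apply: eq_bigr => a _; rewrite tmonomial_generic. Qed.

Lemma coord_val_cidx (x : algstr p q K d) i ba : coord_val x (@cidx i ba) = x i ba.
Proof. by rewrite /coord_val enum_rankK. Qed.

Lemma peval_tm (x : algstr p q K d) u b a :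
  peval ('X_[@tm u b a] : KU) x = tmonomial x u (b, a).
Proof.
rewrite tmonomialE /peval -mprodXE rmorph_prod; apply: eq_bigr => i _.
rewrite -mprodXE rmorph_prod; apply: eq_bigr => j _ /=.
by rewrite mevalXU coord_val_cidx.
Qed.

Lemma peval_inv_poly s (x : algstr p q K d) :
  peval (inv_poly K d s) x = basic_inv x s.
Proof.
case: s => u s; rewrite -/(psym s) inv_polyE basic_invE /peval rmorph_sum.
by apply: eq_bigr => a _; apply: peval_tm.
Qed.

(** The degree of m in the entries of x_i. *)
Definition mtype i (m : 'X_{1..N}) : nat := \sum_(c | ctype c == i) m c.

Lemma mtype_tm u b a i : mtype i (@tm u b a) = val u i.
Proof.
rewrite /mtype; under eq_bigr => c _ do rewrite mnm_sumE.
rewrite exchange_big (bigD1 i) //= [X in (_ + X)%N]big1 ?addn0 => [|i' i'i]; last first.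
  rewrite big1 // => c /eqP ci; rewrite mnm_sumE big1 // => j _; rewrite mnm1E.
  by case: eqP => // ce; rewrite -ce ctype_cidx in ci; rewrite ci eqxx in i'i.
under eq_bigr => c _ do rewrite mnm_sumE.
rewrite exchange_big; transitivity (\sum_(j < val u i) 1)%N; last by rewrite sum1_card card_ord.
apply: eq_bigr => j _ /=.
rewrite (bigD1 (cidx (msub b (posP j), msub a (posQ j)))) ?ctype_cidx //= mnm1E eqxx.
by rewrite big1 // => c /andP[_]; rewrite mnm1E eq_sym => /negPf->.
Qed.

Lemma posP_surj u x : exists i (j : 'I_(val u i)) k, x = @posP r p q u i j k.
Proof.
have [i [j [k xE]]] := pos_surj (cast_ord (esym (deg_out u)) x).
by exists i, j, k; rewrite /posP -xE cast_ordKV.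
Qed.

Lemma posQ_surj u x : exists i (j : 'I_(val u i)) k, x = @posQ r p q u i j k.
Proof.
have [i [j [k xE]]] := pos_surj (cast_ord (esym (deg_in u)) x).
by exists i, j, k; rewrite /posQ -xE cast_ordKV.
Qed.

Lemma tm_alpha u t b a : @tm u (msub b (alpha_p t)) (msub a (alpha_q t)) = tm b a.
Proof.
apply: eq_bigr => i _; rewrite [RHS](reindex_inj (@perm_inj _ (t i))).
apply: eq_bigr => j _; congr (U_(cidx (_, _)))%MM; apply/ffunP=> k; rewrite !ffunE.
  by rewrite alpha_posP.
by rewrite alpha_posQ.
Qed.

(** The monomial determines for each i the multiset of entries of x_i in it; matching the two lists
    of factors permutes the copies of x_i. *)
Lemma tm_eq_alpha u b a b' a' : @tm u b a = tm b' a' ->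
  exists t : {dffun forall i, 'S_(val u i)},
    b' = msub b (alpha_p t) /\ a' = msub a (alpha_q t).
Proof.
move=> e; pose f (b a : multi d (deg u)) i (j : 'I_(val u i)) :=
  @cidx i (msub b (posP j), msub a (posQ j)).
have fE (b1 a1 : multi d (deg u)) i c : (\sum_j U_(@f b1 a1 i j))%MM c = if ctype c == i then
  tm b1 a1 c else 0%N.
  rewrite /tm mnm_sumE [in RHS]mnm_sumE; case: eqP => [ci|ci]; last first.
    by rewrite big1 // => j _; rewrite mnm1E; case: eqP => // fc; case: ci; rewrite -fc ctype_cidx.
  rewrite [RHS](bigD1 i) //= mnm_sumE [X in (_ + X)%N]big1 ?addn0 // => i' i'i.
  rewrite mnm_sumE big1 // => j _; rewrite mnm1E; case: eqP => // fc.
  by rewrite -fc ctype_cidx in ci; rewrite ci eqxx in i'i.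
have /fin_all_exists[s sP] i : exists s : 'S_(val u i), forall j, @f b' a' i j = f b a i (s j).
  by apply: eq_sum_U_perm; apply/mnmP=> c; rewrite !fE e.
exists [ffun i => s i]; split; apply/ffunP=> x.
  have [i [j [k ->]]] := posP_surj x; have /cidx_inj[/ffunP/(_ k) + _] := sP i j.
  by rewrite !ffunE alpha_posP ffunE.
have [i [j [k ->]]] := posQ_surj x; have /cidx_inj[_ /ffunP/(_ k)] := sP i j.
by rewrite !ffunE alpha_posQ ffunE.
Qed.

Definition perm_family u := {dffun forall i, 'S_(val u i)}.

Definition family_mul u (s t : perm_family u) : perm_family u :=
  [ffun i => (s i * t i)%g : 'S_(val u i)].

Definition family_inv u (s : perm_family u) : perm_family u :=
  [ffun i => (s i)^-1%g : 'S_(val u i)].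

Lemma family_mul_bij u (w : perm_family u) : bijective ((@family_mul u)^~ w).
Proof.
exists ((@family_mul u)^~ (family_inv w)) => t; apply/ffunP=> i; rewrite !ffunE.
  exact: mulgK.
exact: mulgKV.
Qed.

Lemma alpha_p_mul u (s t : perm_family u) :
  alpha_p (family_mul s t) = (alpha_p s * alpha_p t)%g.
Proof.
apply/permP=> x; have [i [j [k ->]]] := posP_surj x.
by rewrite permM !alpha_posP ffunE permM.
Qed.

Lemma alpha_q_mul u (s t : perm_family u) :
  alpha_q (family_mul s t) = (alpha_q s * alpha_q t)%g.
Proof.
apply/permP=> x; have [i [j [k ->]]] := posQ_surj x.
by rewrite permM !alpha_posQ ffunE permM.
Qed.

(** For each i, list the coordinates of type i in m with multiplicity: one for each of the
    [mtype i m] copies of x_i. Their indices glue to b and a. *)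
Lemma monomial_tm (m : 'X_{1..N}) :
  (\sum_i p i * mtype i m = \sum_i q i * mtype i m)%N ->
  exists (u : Defs.shape p q) (b a : multi d (deg u)), m = tm b a.
Proof.
move=> bal.
have ubal : balanced p q [ffun i => mtype i m].
  by apply/eqP; under eq_bigr do rewrite ffunE; rewrite bal; apply: eq_bigr => i _; rewrite ffunE.
pose u : Defs.shape p q := exist (balanced p q) _ ubal.
have uE i : val u i = mtype i m by rewrite ffunE.
pose l i := flatten [seq nseq (m c) c | c <- index_enum 'I_N & ctype c == i].
have countE i (P : pred 'I_N) : count P (l i) = (\sum_(c | ctype c == i) P c * m c)%N.
  rewrite count_flatten sumnE !big_map big_filter; apply: eq_bigr => c _.
  exact: count_nseq.
have sz i : size (l i) = val u i.
  by rewrite uE -(count_predT (l i)) countE; apply: eq_bigr => c _; rewrite mul1n.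
have /fin_all_exists[e eP] i : exists e : 'I_(val u i) -> entry p q d i,
    (\sum_j U_(cidx (e j)))%MM = [multinom (if ctype c == i then m c else 0%N) | c < N].
  have /fin_all_exists[e eP] (j : 'I_(val u i)) : exists ba : entry p q d i,
      forall x0, nth x0 (l i) j = cidx ba.
    case: (l i) (sz i) (countE i) => [|x0 l'] sz' countE'; first by case: j => j; rewrite -sz'.
    have : nth x0 (x0 :: l') j \in x0 :: l' by rewrite mem_nth ?sz'.
    rewrite -has_pred1 has_count countE' lt0n => nz.
    have ci : ctype (nth x0 (x0 :: l') j) = i.
      apply/eqP; apply: contraNT nz => ci; rewrite big1 // => c /eqP cc.
      by rewrite /=; case: eqP => //= ce; rewrite -ce cc eqxx in ci.
    have [ba] := cidx_surj (nth x0 (x0 :: l') j); move: ba; rewrite ci => ba cE.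
    by exists ba => x1; rewrite -cE; apply: set_nth_default; rewrite sz'.
  exists e; apply/mnmP=> c; rewrite mnm_sumE mnmE.
  transitivity (count_mem c (l i)); last first.
    rewrite countE; case: eqP => [ci|ci]; last first.
      by rewrite big1 // => c' /eqP c'i /=; case: eqP => // cc; rewrite cc in c'i.
    rewrite (bigD1 c) ?ci //= eqxx mul1n big1 ?addn0 // => c' /andP[_ /negPf].
    by rewrite /= => ->.
  rewrite -sum1_count (big_nth c) sz big_mkord [RHS]big_mkcond; apply: eq_bigr => j _.
  by rewrite mnm1E /= (eP j c); case: eqP.
have glue (k n : 'I_r -> nat) (f : forall i, 'I_(n i) -> multi d (k i)) :
    exists b : multi d (\sum_i \sum_(j < n i) k i)%N,
      forall i (j : 'I_(n i)) l, b (pos j l) = f i j l.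
  pose B i := sval (glue_blocksP (f i)).
  exists (sval (glue_blocksP B)) => i j l'.
  have /ffunP/(_ (@tagnat.Rank (n i) (fun=> k i) j l')) := svalP (glue_blocksP B) i.
  have /ffunP/(_ l') := svalP (glue_blocksP (f i)) j.
  by rewrite !ffunE => <-.
have [b bP] := glue p _ (fun i j => (e i j).1).
have [a aP] := glue q _ (fun i j => (e i j).2).
exists u, [ffun x => b (cast_ord (esym (deg_out u)) x)], [ffun x => a (cast_ord (esym (deg_in
  u)) x)].
apply/mnmP=> c; rewrite mnm_sumE (bigD1 (ctype c)) //= [X in (_ + X)%N]big1 ?addn0 => [|i ic].
  transitivity ((\sum_j U_(cidx (e (ctype c) j)))%MM c); first by rewrite eP mnmE eqxx.
  congr (fun m : 'X_{1..N} => m c); apply: eq_bigr => j _; congr (U_(cidx _))%MM.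
  rewrite [LHS]surjective_pairing; congr (_, _); apply/ffunP=> k; rewrite !ffunE.
    by rewrite /posP cast_ordK bP.
  by rewrite /posQ cast_ordK aP.
rewrite mnm_sumE big1 // => j _; rewrite mnm1E; case: eqP => // ce.
by rewrite -ce ctype_cidx eqxx in ic.
Qed.

End Monomials.

(** * The kernel of the evaluation *)

Section Ideals.
Variables (A : comNzRingType) (S : A -> Prop).

Lemma ideal_genDr a b : ideal_gen S a -> ideal_gen S b -> ideal_gen S (a + b).
Proof.
by elim=> [|c a' b' Sa _ IH] Sb; rewrite ?add0r // -addrA; apply: ideal_genD => //; apply: IH.
Qed.

Lemma ideal_gen_in a : S a -> ideal_gen S a.
Proof. by move=> Sa; rewrite -[a]mul1r -[_ * a]addr0; apply: ideal_genD Sa (ideal_gen0 S). Qed.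

Lemma ideal_genMl c a : ideal_gen S a -> ideal_gen S (c * a).
Proof.
elim=> [|k a' b' Sa _ IH]; first by rewrite mulr0; apply: ideal_gen0.
by rewrite mulrDr mulrA; apply: ideal_genD.
Qed.

End Ideals.

(** Modulo [W], F s does not change under the action, so #|H| times the sum is congruent to the sum
    with coefficients added up over H, and #|H| is invertible. *)
Lemma averaging (K : fieldType) (V : lmodType K) (W : V -> Prop) (H S : finType)
    (act : H -> S -> S) (F : S -> V) (c : S -> K) :
  W 0 -> (forall k u v, W u -> W v -> W (k *: u + v)) -> #|H|%:R != 0 :> K ->
  (forall t s, W (F s - F (act t s))) ->
  W (\sum_s (\sum_t \sum_(s' | act t s' == s) c s') *: F s) ->
  W (\sum_s c s *: F s).
Proof.
move=> W0 WD H0 WF.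
have -> : \sum_s (\sum_t \sum_(s' | act t s' == s) c s') *: F s =
    \sum_t \sum_s c s *: F (act t s).
  under eq_bigr => s _ do rewrite scaler_suml.
  rewrite exchange_big; apply: eq_bigr => t _ /=.
  under eq_bigr => s _ do rewrite scaler_suml.
  rewrite (exchange_big_dep xpredT) //=; apply: eq_bigr => s' _.
  by rewrite (big_pred1 (act t s')) // => s; rewrite eq_sym.
have W_D u v : W u -> W v -> W (u + v) by rewrite -{2}[u]scale1r; apply: WD.
have W_Z k u : W u -> W (k *: u) by move=> Wu; rewrite -[_ *: _]addr0; apply: WD.
have WB : W (\sum_t \sum_s c s *: (F s - F (act t s))).
  by do 2![apply: (big_ind W) => // ? _]; apply: W_Z.
move=> WT; rewrite -[X in W X]scale1r -(mulVf H0) -scalerA; apply: W_Z.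
have -> : #|H|%:R *: \sum_s c s *: F s =
    \sum_t \sum_s c s *: (F s - F (act t s)) + \sum_t \sum_s c s *: F (act t s).
  rewrite -big_split scaler_nat -sumr_const; apply: eq_bigr => t _ /=.
  by rewrite -big_split; apply: eq_bigr => s _; rewrite /= -scalerDr subrK.
exact: W_D.
Qed.

Section Kernel.
Variables (K : fieldType) (r : nat) (p q : 'I_r -> nat) (d : nat).
Hypothesis charK : [pchar K] =i pred0.
Variables (Y : algstr p q K d -> Prop) (E : KU p q K d -> symalg p q K).
Implicit Types u : Defs.shape p q.
Local Notation ideal := (ideal_gen (relation Y E)).
Local Notation X := (@Xsym r p q K).
Local Notation symalg := (symalg p q K).

Lemma ideal_scale c (a : symalg) : ideal a -> ideal (c *: a).
Proof. by move=> Ia; rewrite -mul_malgC; apply: ideal_genMl. Qed.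

Lemma ideal_sum (I : Type) (s : seq I) (P : pred I) (F : I -> symalg) :
  (forall i, P i -> ideal (F i)) -> ideal (\sum_(i <- s | P i) F i).
Proof.
by move=> IF; apply: (big_ind (fun a => ideal a)) => //; [exact: ideal_gen0|exact: ideal_genDr].
Qed.

Lemma eval_sym_scale c (a : symalg) : eval_sym d (c *: a) = c *: eval_sym d a.
Proof. by rewrite /eval_sym monalg.mmapZ mul_mpolyC. Qed.

Lemma eval_symM (a b : symalg) : eval_sym d (a * b) = eval_sym d a * eval_sym d b.
Proof. exact: rmorphM. Qed.

Lemma eval_symB (a b : symalg) : eval_sym d (a - b) = eval_sym d a - eval_sym d b.
Proof. exact: rmorphB. Qed.

Lemma eval_symD (a b : symalg) : eval_sym d (a + b) = eval_sym d a + eval_sym d b.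
Proof. exact: rmorphD. Qed.

Lemma eval_sym_scaleX c s : eval_sym d (c *: X s) = c *: inv_poly K d s.
Proof. by rewrite eval_sym_scale eval_symX. Qed.

Lemma malgU_mul (m1 m2 : {cmonom sym p q}) :
  << monalg.mmul m1 m2 >> = << m1 >> * << m2 >> :> symalg.
Proof. by rewrite malgM_def fgmulUU mulr1. Qed.

(* Unlike (R0), (R1) and (R2), the relations (R3) need not evaluate to 0. *)
Let null a := ideal a /\ eval_sym d a = 0.

Let null_D a b : null a -> null b -> null (a + b).
Proof.
by move=> [Ia a0] [Ib b0]; split; [exact: ideal_genDr|rewrite rmorphD /= a0 b0 addr0].
Qed.

Let null_M c a : null a -> null (c * a).
Proof. by move=> [Ia a0]; split; [exact: ideal_genMl|rewrite rmorphM /= a0 mulr0]. Qed.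

Lemma null_R0_mul s t : null (X s * X t - X (sym_mul s t)).
Proof.
split; first exact/ideal_gen_in/R0_mul.
rewrite eval_symB eval_symM.
apply: etrans (congr2 (fun f g => f - g)
  (congr2 *%R (eval_symX K d s) (eval_symX K d t)) (eval_symX K d (sym_mul s t))) _.
by rewrite [_ * _](basic_inv_R0_mul (generic_point p q K d) s t); apply: subrr.
Qed.

Lemma null_R0_one : null (X (psym (1%g : 'S_(deg (shape0 p q)))) - 1).
Proof.
split; first exact/ideal_gen_in/R0_one.
rewrite eval_symB.
apply: etrans (congr2 (fun f g => f - g) (eval_symX K d _) (rmorph1 (eval_sym d))) _.
by rewrite [inv_poly _ _ _](basic_inv_R0_one (generic_point p q K d)); apply: subrr.
Qed.

(* (R0) turns every monomial in the symbols into a single symbol. *)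
Lemma monomial_symbol (m : {cmonom sym p q}) : exists s, null (<< m >> - X s).
Proof.
have [k] := ubnP (monalg.mdeg m); elim: k m => // k IH m /ltnSE mk.
have [->|m1] := eqVneq m (onecm (sym p q)).
  exists (psym (1%g : 'S_(deg (shape0 p q)))).
  by rewrite -opprB -mulN1r; apply/null_M/null_R0_one.
have [s sm] : exists s, s \in finsupp m.
  apply: NNPP => nos; case/eqP: m1; apply/eqP/cmP => s; rewrite onecmE; apply/eqP.
  by rewrite cmE_eq0; apply/negP=> sm; case: nos; exists s.
pose m' := divcm m (ucm s).
have mE : m = monalg.mmul (ucm s) m'.
  apply/eqP/cmP => t; rewrite cmM divcmE ucmE; case: eqP => [<-|_]; last by rewrite subn0.
  by rewrite subnKC // lt0n cmE_neq0.
have [|s' s'P] := IH m'.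
  by move: mk; rewrite mE mdegM mdegU.
exists (sym_mul s s'); rewrite mE malgU_mul.
have -> : << ucm s >> * << m' >> - X (sym_mul s s') =
    X s * (<< m' >> - X s') + (X s * X s' - X (sym_mul s s')) :> symalg.
  by rewrite mulrBr addrA subrK.
by apply: null_D; [exact: null_M|exact: null_R0_mul].
Qed.

Lemma malgU_scale c (m : {cmonom sym p q}) : << c *g m >> = c *: << m >> :> symalg.
Proof. by rewrite -mul_malgC malgM_def fgmulUU mulr1 monalg.mul1m. Qed.

Lemma linear_symbols (a : symalg) :
  exists l : seq (K * sym p q), null (a - \sum_(x <- l) x.1 *: X x.2).
Proof.
rewrite [a]monalgE; elim: (enum_fset (monalg.msupp a)) => [|m s [l lP]].
  by exists [::]; rewrite !big_nil subrr; split; [exact: ideal_gen0|rewrite rmorph0].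
have [t tP] := monomial_symbol m.
exists ((monalg.mcoeff m a, t) :: l); rewrite !big_cons opprD addrACA; apply: null_D => //.
by rewrite malgU_scale -scalerBr -mul_malgC; apply: null_M.
Qed.

(** By averaging with (R1) it suffices to treat c', whose matrix is T. T is constant on the pairs
    (b, a) with a common monomial, and its sum over them is a multiple of a coefficient of the zero
    polynomial, so T = 0 in characteristic zero. The rest is (R2). *)
Lemma kernel_shape u (c : 'S_(deg u) -> K) :
  \sum_s c s *: inv_poly K d (psym s) = 0 -> ideal (\sum_s c s *: X (psym s)).
Proof.
move=> c0.
pose H := perm_family u.
pose act (t : H) s := Defs.pcomp (Defs.pcomp (alpha_q t) s) (alpha_p t)^-1%g.
pose c' s := \sum_(t : H) \sum_(s' | act t s' == s) c s'.
pose T0 (b a : multi d (deg u)) := \sum_(s : 'S_(deg u) | msub a s == b) c s.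
pose T b a := \sum_(t : H) T0 (msub b (alpha_p t)) (msub a (alpha_q t)).
have T_inv (w : H) b a : T (msub b (alpha_p w)) (msub a (alpha_q w)) = T b a.
  rewrite /T [RHS](reindex ((@family_mul _ p q u)^~ w)); last exact/onW_bij/family_mul_bij.
  apply: eq_bigr => t _; rewrite !msubA; congr T0; apply: eq_msub => j.
    by rewrite alpha_p_mul permM.
  by rewrite alpha_q_mul permM.
have fib0 m : \sum_(ba : multi d (deg u) * multi d (deg u) | tm ba.1 ba.2 == m) T0 ba.1 ba.2 = 0.
  have := congr1 (mcoeff m) c0; rewrite mcoeff0 raddf_sum /= => cm0; rewrite -[RHS]cm0.
  under [RHS]eq_bigr => s _ do rewrite inv_polyE mcoeffZ raddf_sum big_distrr /=.
  rewrite /T0 (exchange_big_dep xpredT) //=; apply: eq_bigr => s _.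
  rewrite (reindex_onto (fun a => (msub a s, a)) snd) /=; last first.
    by case=> b a /andP[_ /eqP /= <-].
  rewrite big_mkcond; apply: eq_bigr => a _; rewrite !eqxx !andbT mcoeffX.
  by case: eqP => _; rewrite ?mulr1 ?mulr0.
have T_0 b0 a0 : T b0 a0 = 0.
  have fibT : \sum_(ba : multi d (deg u) * multi d (deg u) | tm ba.1 ba.2 == tm b0 a0) T ba.1
    ba.2 = 0.
    rewrite exchange_big big1 // => t _ /=; rewrite -[RHS](fib0 (tm b0 a0)).
    rewrite [RHS](reindex (fun ba => (msub ba.1 (alpha_p t), msub ba.2 (alpha_q t)))) /=.
      by apply: eq_bigl => ba; rewrite tm_alpha.
    exists (fun ba => (msub ba.1 (alpha_p t)^-1%g, msub ba.2 (alpha_q t)^-1%g)) => -[b a] _ /=;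
      by rewrite !msubA !msub_id // => j; rewrite /= ?permK ?permKV.
  have fibE : \sum_(ba : multi d (deg u) * multi d (deg u) | tm ba.1 ba.2 == tm b0 a0) T ba.1 ba.2 =
      \sum_(ba : multi d (deg u) * multi d (deg u) | tm ba.1 ba.2 == tm b0 a0) T b0 a0.
    apply: eq_bigr => -[b a] /eqP /= /esym/tm_eq_alpha[t [-> ->]]; exact: T_inv.
  move: fibT; rewrite fibE sumr_const -mulr_natr => /eqP.
  rewrite mulf_eq0 ((pcharf0P K).1 charK) => /orP[/eqP//|/eqP/card0_eq/(_ (b0, a0))].
  by move=> /negbT/negP[]; apply/eqP.
have c'0 (a b : multi d (deg u)) : \sum_(s : 'S_(deg u) | msub a s == b) c' s = 0.
  rewrite -[RHS](T_0 b a) /c' /T exchange_big; apply: eq_bigr => t _ /=.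
  rewrite (exchange_big_dep (fun s' => msub a (act t s') == b)) /=; last first.
    by move=> s s' /eqP<- /eqP->.
  apply: eq_big => [s'|s' s'P]; last first.
    rewrite (big_pred1 (act t s')) // => s; rewrite /= [RHS]eq_sym.
    by case: (act t s' =P s) => [<-|_]; rewrite ?andbF // s'P.
  apply/eqP/eqP => [<-|e].
    by rewrite !msubA; apply: eq_msub => j; rewrite /= !permM permK.
  have := congr1 (fun b => msub b (alpha_p t)^-1%g) e.
  rewrite /= !msubA [X in _ = X]msub_id => [<-|j]; last by rewrite /= permKV.
  by apply: eq_msub => j; rewrite /= !permM.
have Ic' : ideal (\sum_s c' s *: X (psym s)).
  apply: (second_fundamental_perm (W := fun a => ideal a)) c'0.
  - exact: ideal_gen0.
  - by move=> k a b Ia Ib; apply: ideal_genDr => //; apply: ideal_scale.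
  - by move=> t1 t2 du; apply/ideal_gen_in/R2.
apply: (averaging (W := fun a => ideal a) (act := act)) Ic'.
- exact: ideal_gen0.
- by move=> k a b Ia Ib; apply: ideal_genDr => //; apply: ideal_scale.
- rewrite ((pcharf0P K).1 charK) -lt0n; apply/card_gt0P.
  by exists [ffun i => 1%g : 'S_(val u i)].
- by move=> t s; apply/ideal_gen_in/R1.
Qed.

(** After (R0) a linear combination of symbols remains; symbols of different shapes evaluate to
    different multidegrees, so it vanishes shape by shape. *)
Lemma eval_sym_kernel a : eval_sym d a = 0 -> ideal a.
Proof.
move=> a0; have [l [la la0]] := linear_symbols a.
have l0 : \sum_(x <- l) x.1 *: inv_poly K d x.2 = 0.
  move: la0; rewrite eval_symB a0 sub0r => /eqP; rewrite oppr_eq0 => /eqP la0.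
  rewrite -[RHS]la0 rmorph_sum; apply: eq_bigr => x _.
  exact: esym (eval_sym_scaleX _ _).
rewrite -[a](subrK (\sum_(x <- l) x.1 *: X x.2)); apply: ideal_genDr => //.
pose shapes := undup [seq tag x.2 | x <- l].
pose c (u : Defs.shape p q) (s : 'S_(deg u)) := \sum_(x <- l | x.2 == psym s) x.1.
have lE (V : lmodType K) (F : sym p q -> V) u :
    \sum_(x <- l | tag x.2 == u) x.1 *: F x.2 = \sum_s c u s *: F (psym s).
  under [RHS]eq_bigr => s _ do rewrite scaler_suml.
  rewrite (exchange_big_dep (fun x => tag x.2 == u)) /=; last first.
    by move=> s x _ /eqP->.
  apply: eq_bigr => -[k [v s]] /= /eqP vu; subst v.
  rewrite (big_pred1 s) // => s'; rewrite -/(psym s).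
  by rewrite eq_Tagged eq_sym.
have splitE (V : lmodType K) (F : sym p q -> V) :
    \sum_(x <- l) x.1 *: F x.2 = \sum_(u <- shapes) \sum_s c u s *: F (psym s).
  under [RHS]eq_bigr => u _ do rewrite -lE.
  rewrite (exchange_big_dep xpredT) //= big_seq [RHS]big_seq; apply: eq_bigr => x xl.
  rewrite big_mkcond (bigD1_seq (tag x.2)) ?undup_uniq //; last first.
    by rewrite mem_undup (map_f (fun x : K * sym p q => tag x.2)).
  rewrite eqxx big1 => [|u]; last by rewrite eq_sym => /negPf->.
  exact: esym (addr0 _).
pose g u := \sum_s c u s *: inv_poly K d (psym s).
have g_type u m i : mtype i m != val u i -> (g u)@_m = 0.
  move=> mi; rewrite raddf_sum big1 // => s _;
    rewrite /= mcoeffZ inv_polyE raddf_sum big1 ?mulr0 //.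
  move=> a' _; rewrite /= mcoeffX; case: eqP => // e.
  by move: mi; rewrite -e mtype_tm eqxx.
rewrite splitE big_seq; apply: ideal_sum => u us; apply: kernel_shape; rewrite -/(g u).
apply/mpolyP=> m; rewrite mcoeff0.
case: (pickP (fun i => mtype i m != val u i)) => [i|um]; first exact: g_type.
have other : \sum_(v <- shapes | v != u) (g v)@_m = 0.
  apply: big1 => v vu.
  have [i vi] : exists i, mtype i m != val v i.
    apply/existsP; apply: contraNT vu => /existsPn vm; apply/eqP/val_inj/ffunP=> i.
    by have /negPn/eqP <- := vm i; have /= /negbFE/eqP := um i.
  exact: g_type vi.
have := congr1 (mcoeff m) l0; rewrite splitE mcoeff0 raddf_sum (bigD1_seq u) ?undup_uniq //.
rewrite -/((g u)@_m + \sum_(v <- shapes | v != u) (g v)@_m) other.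
exact: etrans (esym (addr0 _)).
Qed.

End Kernel.

(** * Invariants on a stable subset *)

Lemma tpow_scalar (R : comNzRingType) d n (t : R) (b a : multi d n) :
  tpow t%:M n (b, a) = t ^+ n * (b == a)%:R.
Proof.
have tn : t ^+ n = \prod_(j < n) t by rewrite prodr_const card_ord.
rewrite tn -tpow1 !ffunE -big_split; apply: eq_bigr => j _.
by rewrite /= !mxE mulr_natr.
Qed.

Section Surjectivity.
Variables (K : fieldType) (r : nat) (p q : 'I_r -> nat) (d : nat).
Hypothesis charK : [pchar K] =i pred0.
Local Notation N := #|{: Defs.coord p q d}|.
Local Notation KU := (KU p q K d).
Local Notation peval := (@peval r p q K d).

(** The scalar matrix t multiplies the monomial m by t^(weight p m - weight q m). *)
Definition weight (w : 'I_r -> nat) (m : 'X_{1..N}) : nat := \sum_i w i * mtype i m.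

Lemma weightE w (m : 'X_{1..N}) : weight w m = (\sum_c w (ctype c) * m c)%N.
Proof.
rewrite (partition_big (@ctype r p q d) xpredT) //=; apply: eq_bigr => i _.
by rewrite big_distrr; apply: eq_bigr => c /eqP->.
Qed.

Lemma coord_val_scalar (x : algstr p q K d) t c :
  coord_val (gl_act t%:M x) c = t ^+ p (ctype c) * t^-1 ^+ q (ctype c) * coord_val x c.
Proof.
have [[b a] ->] := cidx_surj c; rewrite !coord_val_cidx ctype_cidx ffunE tactE.
rewrite (bigD1 b) //= [X in _ + X]big1 ?addr0 => [|b' b'b]; last first.
  by rewrite big1 // => a' _; rewrite tpow_scalar eq_sym (negPf b'b) mulr0 !mul0r.
rewrite (bigD1 a) //= big1 ?addr0 => [|a' a'a]; last first.
  by rewrite invmx_scalar !tpow_scalar (negPf a'a) !mulr0.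
by rewrite invmx_scalar !tpow_scalar !eqxx !mulr1 mulrAC.
Qed.

Lemma peval_monomial_scalar (x : algstr p q K d) t m :
  peval 'X_[m] (gl_act t%:M x) = t ^+ weight p m * t^-1 ^+ weight q m * peval 'X_[m] x.
Proof.
rewrite /Defs.peval !mevalX !weightE !expr_sum -!big_split; apply: eq_bigr => c _ /=.
by rewrite coord_val_scalar !exprMn -!exprM.
Qed.

Lemma pevalE (f : KU) x : peval f x = \sum_(m <- msupp f) f@_m * peval 'X_[m] x.
Proof.
rewrite {1}[f]mpolyE /Defs.peval rmorph_sum; apply: eq_bigr => m _.
by rewrite /= mevalZ.
Qed.

(* Invariance under the scalar matrices: the values at all t <> 0 determine
   the coefficients of a Laurent polynomial in t. *)
Lemma peval_balanced (Y : algstr p q K d -> Prop) (f : KU) x :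
  invariant_on Y f -> Y x ->
  peval f x = \sum_(m <- msupp f | weight p m == weight q m) f@_m * peval 'X_[m] x.
Proof.
move=> invf Yx; pose M := (\max_(m <- msupp f) weight q m)%N.
have le_M m : m \in msupp f -> (weight q m <= M)%N.
  by move=> mf; apply: (leq_bigmax_seq (F := weight q)).
(* The Laurent polynomial of the values at the points t . x, minus its constant value, times t^M to
   clear negative powers; in its first part the coefficient of t^M collects the balanced
   monomials. *)
pose h : {poly K} := \sum_(m <- msupp f)
  (f@_m * peval 'X_[m] x) *: 'X^(weight p m + (M - weight q m)) - peval f x *: 'X^M.
have h0 : h = 0.
  apply: poly_eq0 (char0_infinite charK) _ => t t0.
  have tu : (t%:M : 'M[K]_d) \in unitmx by rewrite unitmxE det_scalar unitfE expf_neq0.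
  rewrite /h !hornerE horner_sum -(invf _ _ tu Yx) [in X in _ - X]pevalE.
  rewrite big_distrl -sumrB big_seq big1 // => m mf /=.
  rewrite hornerZ hornerXn peval_monomial_scalar -(subnK (le_M m mf)) addnK.
  rewrite !exprD exprVn; have := expf_neq0 (weight q m) t0.
  by move: (t ^+ _) (t ^+ _) (t ^+ _) (f@_m) (peval _ _) => A B C k v A0; field.
have /eqP := congr1 (fun g : {poly K} => g`_M) h0.
rewrite coef0 coefB coefZ coefXn eqxx mulr1 subr_eq0 => /eqP <-.
rewrite coef_sum [RHS]big_mkcond big_seq [RHS]big_seq; apply: eq_bigr => m mf.
rewrite coefZ coefXn -{1}(subnKC (le_M m mf)) eqn_add2r eq_sym.
by case: eqP; rewrite ?mulr1 ?mulr0.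
Qed.

Lemma peval_basic_sum (I : finType) (z : I -> K) (s : I -> sym p q) x :
  peval (eval_sym d (\sum_i z i *: Xsym K (s i))) x = \sum_i z i * basic_inv x (s i).
Proof.
rewrite rmorph_sum /Defs.peval rmorph_sum; apply: eq_bigr => i _.
transitivity (peval (z i *: inv_poly K d (s i)) x).
  by congr Defs.peval; exact: eval_sym_scaleX.
by rewrite /Defs.peval mevalZ; congr (_ * _); apply: peval_inv_poly.
Qed.

(** A balanced monomial is an entry of some tensor monomial, on which g acts by conjugation;
    averaging replaces the matrix unit by a combination of the L_t, that is, the entry by traces. *)
Lemma reynolds_monomial (s : seq (K * 'M[K]_d)) (m : 'X_{1..N}) :
  weight p m = weight q m -> reynolds_for s (weight p m) ->
  exists a : symalg p q K, forall x,
    \sum_(y <- s) y.1 * peval 'X_[m] (gl_act y.2 x) = peval (eval_sym d a) x.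
Proof.
move=> /monomial_tm[u [b [a ->]]].
have -> : weight p (tm b a) = deg u by apply: eq_bigr => i _; rewrite mtype_tm.
move=> /(_ b a)[z zP]; exists (\sum_t z t *: Xsym K (psym t)) => x.
rewrite peval_basic_sum.
transitivity (\sum_c \sum_c' tmonomial x u (c, c') * \sum_(y <- s) y.1 * conj_entry y.2 b a c c').
  under eq_bigr => y _ do rewrite peval_tm tmonomial_act tactE big_distrr /=.
  rewrite exchange_big; apply: eq_bigr => c _ /=.
  under eq_bigr => y _ do rewrite big_distrr /=.
  rewrite exchange_big; apply: eq_bigr => c' _ /=.
  rewrite big_distrr; apply: eq_bigr => y _; rewrite /conj_entry /=; ring.
under eq_bigr => c _ do under eq_bigr => c' _ do rewrite zP big_distrr /=.
under eq_bigr => c _ do rewrite exchange_big /=.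
rewrite exchange_big; apply: eq_bigr => t _ /=; rewrite basic_invE exchange_big big_distrr.
apply: eq_bigr => c' _ /=; rewrite (bigD1 (msub c' t)) //= eqxx mulr1 big1 ?addr0 => [|c].
  by rewrite mulrC.
by rewrite eq_sym => /negPf->; rewrite !mulr0.
Qed.

(** On Y, f equals its average over s. Stability keeps the moved points in Y, so only balanced
    monomials count, and each of them averages to a combination of basic invariants on all of
    U_d. *)
Lemma invariant_on_generated (Y : algstr p q K d -> Prop) (f : KU) :
  GL_stable Y -> invariant_on Y f -> exists a : symalg p q K, eq_on Y f (eval_sym d a).
Proof.
move=> stableY invf.
have [s /andP[/allP su /eqP s1] sP] :=
  reynolds_lt d charK (\max_(m <- msupp f) weight p m).+1.
suff [a aP] : exists a : symalg p q K, forall x,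
    \sum_(m <- msupp f | weight p m == weight q m)
      f@_m * \sum_(y <- s) y.1 * peval 'X_[m] (gl_act y.2 x) = peval (eval_sym d a) x.
  exists a => x Yx; rewrite [LHS]mevalB -[X in _ - X]aP; apply/eqP; rewrite subr_eq0; apply/eqP.
  transitivity (\sum_(y <- s) y.1 * peval f (gl_act y.2 x)).
    rewrite -[LHS]mul1r -s1 big_distrl big_seq [RHS]big_seq; apply: eq_bigr => y /su yu /=.
    by rewrite invf.
  rewrite big_seq; under eq_bigr => y /su yu do
    rewrite (peval_balanced invf (stableY _ _ yu Yx)) big_distrr /=.
  rewrite -big_seq exchange_big; apply: eq_bigr => m _ /=.
  by rewrite big_distrr; apply: eq_bigr => y _; rewrite mulrCA.
(* The induction shortens only the list of summation; the coefficients stay those of f, and the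
   inclusion keeps the degree bound. *)
have : {subset msupp f <= msupp f} by [].
elim: {1 3}(msupp f) => [_|m l IH sub].
  by exists 0 => x; rewrite big_nil rmorph0 /Defs.peval meval0.
have [|a aP] := IH; first by move=> m' m'l; rewrite sub // in_cons m'l orbT.
have [bal|nbal] := boolP (weight p m == weight q m); last first.
  by exists a => x; rewrite big_cons (negPf nbal) aP.
have [|b bP] := reynolds_monomial (s := s) (eqP bal).
  by apply: sP; rewrite ltnS; apply: (leq_bigmax_seq (F := weight p)); rewrite ?sub ?mem_head.
exists (f@_m *: b + a) => x; rewrite big_cons bal aP bP.
rewrite eval_symD (eval_sym_scale _ _ b) /Defs.peval mevalD mevalZ.
by [].
Qed.

End Surjectivity.

(** * The ideal of relations on a stable subset *)

Section Presentation.
Variables (K : fieldType) (r : nat) (p q : 'I_r -> nat) (d : nat).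
Variables (Y : algstr p q K d -> Prop) (E : KU p q K d -> symalg p q K).

Lemma peval_Xsym (x : algstr p q K d) s : peval (eval_sym d (Xsym K s)) x = basic_inv x s.
Proof. by rewrite eval_symX peval_inv_poly. Qed.

Lemma eval_sym_invariant (a : symalg p q K) : invariant_on (@whole r p q K d) (eval_sym d a).
Proof.
move=> g x gu _; have [l [_ l0]] := linear_symbols Y E a.
have -> : eval_sym d a = \sum_(y <- l) y.1 *: inv_poly K d y.2.
  move: l0; rewrite eval_symB => /eqP; rewrite subr_eq0 => /eqP ->.
  rewrite rmorph_sum; apply: eq_bigr => y _.
  exact: eval_sym_scaleX.
rewrite /peval !rmorph_sum; apply: eq_bigr => y _; rewrite /= !mevalZ; congr (_ * _).
rewrite -!/(peval _ _) !peval_inv_poly; exact: basic_inv_act.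
Qed.

Lemma relation_vanishes a :
  expressions Y E -> relation Y E a -> vanishing_ideal Y (eval_sym d a).
Proof.
move=> exprE; case=> {a} [s t||u s t|u t1 t2 du|f If invf] x Yx.
- by have [_ ->] := null_R0_mul Y E s t; apply: meval0.
- by have [_ ->] := null_R0_one Y E; apply: meval0.
- rewrite eval_symB [LHS]mevalB; apply/eqP; rewrite subr_eq0; apply/eqP.
  apply: etrans (peval_Xsym x _) _; apply: etrans _ (esym (peval_Xsym x _)).
  exact: basic_inv_R1.
- rewrite rmorph_sum /peval rmorph_sum -[RHS](basic_inv_R2 x t1 t2 du); apply: eq_bigr => s _.
  rewrite (_ : GRing.RMorphism.sort _ _ = (-1) ^+ s *: inv_poly K d (psym (Defs.pcomp
    (Defs.pcomp t1 s) t2))).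
    by rewrite /= mevalZ; congr (_ * _); apply: peval_inv_poly.
  exact: eval_sym_scaleX.
- by rewrite exprE //; apply: If.
Qed.

Lemma ideal_vanishes a :
  expressions Y E -> ideal_gen (relation Y E) a -> vanishing_ideal Y (eval_sym d a).
Proof.
move=> exprE; elim=> [|c a' b Ra _ IH] x Yx; first by rewrite rmorph0; apply: meval0.
rewrite eval_symD eval_symM [LHS]mevalD mevalM -!/(peval _ x) (relation_vanishes exprE Ra Yx).
by rewrite mulr0 add0r; apply: IH.
Qed.

(** If the invariant [eval_sym d a] vanishes on Y, its chosen expression lies in the ideal by (R3);
    subtracting it from a leaves an element evaluating to 0 on all of U_d. *)
Lemma presentation (charK : [pchar K] =i pred0) a :
  expressions Y E -> vanishing_ideal Y (eval_sym d a) <-> ideal_gen (relation Y E) a.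
Proof.
move=> exprE; split; last exact: ideal_vanishes.
move=> Ia; have invf := eval_sym_invariant a.
rewrite -[a](subrK (E (eval_sym d a))); apply: ideal_genDr; last exact/ideal_gen_in/R3.
by apply: (eval_sym_kernel charK (d := d)); rewrite eval_symB exprE // subrr.
Qed.

End Presentation.

Theorem theorem1p1 (K : closedFieldType) (charK : [pchar K] =i pred0)
    (r : nat) (p q : 'I_r -> nat) (d : nat) (Y : algstr p q K d -> Prop)
    (Yclosed : zariski_closed Y) (Ystable : GL_stable Y) :
  [/\ forall s : sym p q, invariant_on Y (inv_poly K d s),
      forall f : KU p q K d, invariant_on Y f ->
        exists a : symalg p q K, eq_on Y f (eval_sym d a)
    & forall E : KU p q K d -> symalg p q K, expressions Y E ->
        forall a : symalg p q K,
          vanishing_ideal Y (eval_sym d a) <-> ideal_gen (relation Y E) a].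
Proof.
split=> [s g x gu _|f|E exprE a].
- by rewrite !peval_inv_poly; apply: basic_inv_act.
- exact: invariant_on_generated.
- exact: presentation.
Qed.
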